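(* Fix an integer $n \ge 2$ and a splitting type $\mu \in T_n^{*}$. Let $K_{\mathfrak p}$ range over finite extensions of $p$-adic fields $\mathbb{Q}_p$, where the prime $p$ and the residue degree $f$ may both vary in any way, such that the order $q = p^f$ of the residue field of $K_{\mathfrak p}$ tends to infinity. Then $$\nu_{n,\mathfrak p}\left(P^{*}_{n,\mathfrak p}(\mu)\right) \to \nu_n(\mu) \quad \text{as } q \to \infty,$$ and in consequence $$\nu_{n,\mathfrak p}\left(P_{n,\mathfrak p}(\mu)\right) \to \nu_n(\mu) \quad \text{as } q \to \infty.$$
   Context: For a finite extension $K_{\mathfrak p}$ of $\mathbb{Q}_p$, $\mathfrak{O}_{\mathfrak p}$ is its ring of integers, $\mathfrak p$ the maximal ideal, and $\mathbb{F}_q=\mathfrak{O}_{\mathfrak p}/\mathfrak p$ the residue field. Let $h_{\mathfrak p}$ be the additive Haar measure on $\mathfrak{O}_{\mathfrak p}$ with total mass $1$, and let $\nu_{n,\mathfrak p}$ be the product measure $h_{\mathfrak p}^{\otimes n}$ on $(\mathfrak{O}_{\mathfrak p})^n$. A tuple $(a_0,\dots,a_{n-1}) \in (\mathfrak{O}_{\mathfrak p})^n$ is identified with the monic polynomial $f(x) = x^n + a_{n-1}x^{n-1} + \cdots + a_0$. $T_n^{*}$ is the set of square-free splitting types of degree $n$, i.e. of partitions $\mu = (\mu_1,\dots,\mu_k)$, $\mu_1 \ge \cdots \ge \mu_k \ge 1$, of $n$. A square-free monic polynomial of degree $n$ has splitting type $\mu$ if the degrees of its monic irreducible factors, in nonincreasing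 order, are $\mu_1,\dots,\mu_k$. $P_{n,\mathfrak p}(\mu)$ is the set of tuples in $(\mathfrak{O}_{\mathfrak p})^n$ whose polynomial $f$ is square-free with splitting type $\mu$ over $\mathfrak{O}_{\mathfrak p}$ (equivalently over $K_{\mathfrak p}$), and $P^{*}_{n,\mathfrak p}(\mu) \subset P_{n,\mathfrak p}(\mu)$ is the subset of those whose discriminant is not divisible by $\mathfrak p$. For $\mu \in T_n^*$, $C_\mu \subset S_n$ is the conjugacy class of all permutations whose cycle lengths (fixed points included) are $\mu_1,\dots,\mu_k$, and $\nu_n(\mu) = |C_\mu|/n!$. Convergence as $q \to \infty$ means: for every $\varepsilon>0$ there is $q_0$ such that the quantity is within $\varepsilon$ of the limit for every prime $p$ and every finite extension $K_{\mathfrak p}/\mathbb{Q}_p$ with residue field of order $q \ge q_0$. *)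

(* Defs.v *)
From HB Require Import structures.
From mathcomp Require Import all_boot all_order all_algebra all_fingroup all_field.
From mathcomp Require Import mathcomp_extra boolp classical_sets reals ereal.
From mathcomp Require Import measure lebesgue_integral probability.

Set Implicit Arguments.
Unset Strict Implicit.
Unset Printing Implicit Defensive.

Import Order.TTheory GRing.Theory Num.Theory.
Local Open Scope classical_set_scope.
Local Open Scope ring_scope.

Definition rat_padic_abs (R : realType) (p : nat) (r : rat) : R :=
  if r == 0 then 0
  else p%:R ^+ logn p `|denq r|%N / p%:R ^+ logn p `|numq r|%N.

(** Q_p is taken up to isomorphism, through its definition as the completion of
    the rationals at the p-adic absolute value: a field with a complete
    absolute value in which the rationals, with their p-adic absolute value,
    are dense. *)
Record padic_numbers (R : realType) (p : nat) := PadicNumbers {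
  Qp :> fieldType;
  Qp_abs : Qp -> R;
  Qp_abs_eq0 : forall x, Qp_abs x = 0 -> x = 0;
  Qp_absM : forall x y, Qp_abs (x * y) = Qp_abs x * Qp_abs y;
  Qp_absD : forall x y, Qp_abs (x + y) <= Num.max (Qp_abs x) (Qp_abs y);
  Qp_abs_rat : forall r : rat, Qp_abs (ratr r) = rat_padic_abs R p r;
  Qp_dense : forall (x : Qp) (e : R), 0 < e ->
    exists r : rat, Qp_abs (x - ratr r) < e;
  Qp_complete : forall u : nat -> Qp,
    (forall e : R, 0 < e -> exists N, forall i j,
       (N <= i)%N -> (N <= j)%N -> Qp_abs (u i - u j) < e) ->
    exists l, forall e : R, 0 < e -> exists N, forall i,
       (N <= i)%N -> Qp_abs (u i - l) < e
}.

Section Zp.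
Variables (R : realType) (p : nat) (Q : padic_numbers R p).

Definition in_Zp : {pred Q} := fun x => Qp_abs x <= 1.

Lemma Qp_abs1 : Qp_abs (1 : Q) = 1.
Proof.
have := Qp_abs_rat Q 1; rewrite /ratr divr1 => ->.
by rewrite /rat_padic_abs oner_eq0 /= logn1 expr0 divr1.
Qed.

Lemma Qp_absN1 : Qp_abs (-1 : Q) = 1.
Proof.
have := Qp_abs_rat Q (-1); rewrite /ratr divr1 => ->.
by rewrite /rat_padic_abs oppr_eq0 oner_eq0 /= logn1 expr0 divr1.
Qed.

Fact in_Zp_subring : subring_closed in_Zp.
Proof.
have absN x : Qp_abs (- x : Q) = Qp_abs x by rewrite -mulN1r Qp_absM Qp_absN1 mul1r.
have abs_ge0 (x : Q) : 0 <= Qp_abs x.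
  have := Qp_absD x (- x); rewrite subrr absN maxxx; apply: le_trans.
  have := Qp_abs_rat Q 0; rewrite /ratr divr1 => ->.
  by rewrite /rat_padic_abs eqxx.
split.
- by change (Qp_abs (1 : Q) <= 1); rewrite Qp_abs1.
- move=> x y hx hy; change (Qp_abs (x - y) <= 1).
  apply: le_trans (Qp_absD x (- y)) _; rewrite absN ge_max.
  by apply/andP; split.
- by move=> x y hx hy; change (Qp_abs (x * y) <= 1); rewrite Qp_absM mulr_ile1.
Qed.

HB.instance Definition _ := GRing.isSubringClosed.Build Q in_Zp in_Zp_subring.

Record Zp := MkZp { Zp_val :> Q; _ : Zp_val \in in_Zp }.
HB.instance Definition _ := [isSub for Zp_val].
HB.instance Definition _ := [Choice of Zp by <:].
HB.instance Definition _ := [SubChoice_isSubComNzRing of Zp by <:].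

End Zp.

Section RingOfIntegers.
Variables (R : realType) (p : nat) (Q : padic_numbers R p).
Variable K : fieldExtType Q.

Definition Zp_to_K : Zp Q -> K := in_alg K \o \val.
HB.instance Definition _ := GRing.RMorphism.on Zp_to_K.

Definition in_integers : {pred K} := fun x => `[< integralOver Zp_to_K x >].

Fact in_integers_subring : subring_closed in_integers.
Proof.
split.
- exact/asboolP/integral1.
- by move=> x y /asboolP hx /asboolP hy; apply/asboolP/integral_sub.
- by move=> x y /asboolP hx /asboolP hy; apply/asboolP/integral_mul.
Qed.

HB.instance Definition _ :=
  GRing.isSubringClosed.Build K in_integers in_integers_subring.

Record integers := MkIntegers { integers_val :> K; _ : integers_val \in in_integers }.
HB.instance Definition _ := [isSub for integers_val].
HB.instance Definition _ := [Choice of integers by <:].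
HB.instance Definition _ := [SubChoice_isSubComNzRing of integers by <:].
HB.instance Definition _ := isPointed.Build integers 0.

(** [integers] is a local ring: its maximal ideal is the set of nonunits. *)
Definition max_ideal : set integers := [set x | ~ exists y, x * y = 1].

(** The p-adic topology. Since p generates a power of the maximal ideal, it is
    also the topology defined by the powers of the maximal ideal. *)
Definition integers_open : set (set integers) :=
  [set U | forall x, U x -> exists k : nat, forall y, U (x + p%:R ^+ k * y)].

Definition borel_integers := g_sigma_algebraType integers_open.

Definition is_haar (h : probability borel_integers R) : Prop :=
  forall (x : integers) (A : set borel_integers), measurable A ->
    h [set x + y | y in (A : set integers)] = h A.

(** [F], through [red], is the quotient of [integers] by its maximal ideal. *)
Definition is_residue_field (F : finFieldType) (red : {rmorphism integers -> F}) :
    Prop :=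
  (forall z : F, exists x, red x = z) /\
  (forall x, red x = 0 <-> max_ideal x).

End RingOfIntegers.

Section PowerProbability.
Context (d : measure_display) (T : measurableType d) (R : realType).
Variable P : probability T R.

Definition tuple_cons (n : nat) (x : T * n.-tuple T) : n.+1.-tuple T :=
  [the n.+1.-tuple T of x.1 :: x.2].

Lemma measurable_tuple_cons n : measurable_fun setT (@tuple_cons n).
Proof. by apply: measurable_cons; [exact: measurable_fst|exact: measurable_snd]. Qed.

HB.instance Definition _ n := isMeasurableFun.Build _ _ _ _ (@tuple_cons n)
  (@measurable_tuple_cons n).

Fixpoint power_probability (n : nat) : probability (n.-tuple T) R :=
  match n with
  | 0 => dirac [tuple]
  | m.+1 => distribution (P \x^ power_probability m)%E (@tuple_cons m)
  end.

End PowerProbability.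

Definition is_splitting_type (n : nat) (mu : seq nat) : bool :=
  [&& sorted geq mu, all (leq 1) mu & sumn mu == n].

Definition square_free (L : fieldType) (f : {poly L}) : Prop :=
  forall g : {poly L}, g ^+ 2 %| f -> size g = 1.

Definition has_splitting_type (L : fieldType) (f : {poly L}) (mu : seq nat) :
    Prop :=
  exists gs : seq {poly L},
    [/\ forall g, g \in gs -> g \is monic /\ irreducible_poly g,
        f = \prod_(g <- gs) g
      & sort geq [seq (size g).-1 | g : {poly L} <- gs] = mu].

(** The discriminant of a monic polynomial. [resultant] is computed from the
    sizes of its arguments, so this relies on [f^`()] having degree
    [(deg f) - 1], as is the case in characteristic 0. *)
Definition disc (A : comNzRingType) (f : {poly A}) : A :=
  (-1) ^+ 'C((size f).-1, 2) * resultant f f^`().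

Definition cycle_class (n : nat) (mu : seq nat) : {set 'S_n} :=
  [set s : 'S_n | sort geq [seq #|c| | c : {set 'I_n} <- enum (porbits s)] == mu]%SET.

Definition nu (R : realType) (n : nat) (mu : seq nat) : R :=
  #|cycle_class n mu|%:R / n`!%:R.

Section PolynomialSets.
Variables (R : realType) (p : nat) (Q : padic_numbers R p).
Variables (K : fieldExtType Q) (n : nat).

Definition monic_of_tuple (a : n.-tuple (integers K)) : {poly integers K} :=
  'X^n + \sum_(i < n) (tnth a i)%:P * 'X^i.

Definition P_set (mu : seq nat) : set (n.-tuple (borel_integers K)) :=
  [set a | let f := map_poly val (monic_of_tuple a) in
           square_free f /\ has_splitting_type f mu].

Definition Pstar_set (mu : seq nat) : set (n.-tuple (borel_integers K)) :=
  [set a | P_set mu a /\ ~ max_ideal (disc (monic_of_tuple a))].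

End PolynomialSets.

Definition tends_as_residue_order_to_oo (R : realType)
    (x : forall (p : nat) (Q : padic_numbers R p) (K : fieldExtType Q),
       probability (borel_integers K) R -> \bar R) (l : R) : Prop :=
  forall e : R, 0 < e -> exists q0 : nat,
    forall (p : nat) (Q : padic_numbers R p) (K : fieldExtType Q)
      (h : probability (borel_integers K) R)
      (F : finFieldType) (red : {rmorphism integers K -> F}),
      prime p -> is_haar h -> is_residue_field red -> (q0 <= #|F|)%N ->
      (`|x p Q K h - l%:E| < e%:E)%E.

(* Main.v *)
From HB Require Import structures.
Require Import Defs.
From mathcomp Require Import all_boot all_order all_algebra all_fingroup all_field.
From mathcomp Require Import boolp reals ereal measure.
From mathcomp Require Import ring zify lra.

Set Implicit Arguments.
Unset Strict Implicit.
Unset Printing Implicit Defensive.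

Import Order.TTheory GRing.Theory Num.Theory.
Local Open Scope ring_scope.

(** Reduction modulo the maximal ideal carries the product of Haar measures to
    the uniform distribution on the [q ^ n] monic polynomials of degree [n] over
    the residue field ([box_measure]). A polynomial whose discriminant is a unit
    has the same splitting type as its reduction; so [Pstar_set] is the preimage
    of the set of separable polynomials of type [mu] over the residue field
    ([Pstar_setE]), and [P_set] exceeds it only by polynomials with inseparable
    reduction, whose proportion is at most [n / q] ([card_inseparable]). Both
    limits thus come down to a count over finite fields.

    The count ([card_separable_le]). A separable polynomial over the field of
    [q] elements has [n`!] orderings of its roots, and Frobenius permutes the
    ordered roots: [x i ^+ q = x (s i)], where the cycle type of [s] is the
    splitting type. For a given [s] this system has at most [q ^ n] solutions,
    because the value at one index determines [x] on its whole cycle. Hence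
    [n`!] times the number of separable polynomials of type [mu] is at most
    [#|cycle_class n mu| * q ^ n]. Over all types together these bounds add up to
    [n`! * q ^ n], the true total apart from inseparable polynomials, so each of
    them is sharp up to the number of inseparable polynomials.

    Splitting types under reduction ([irreducible_reduction]). It is enough that
    an irreducible monic polynomial [g] with separable reduction has irreducible
    reduction. The absolute value is never extended to the root field of [g].
    Instead, Hensel's lemma over the p-adic integers shows that an integral
    element of a field is invertible or nilpotent modulo [p] in the ring it
    generates ([integral_unit_or_nilpotent]). Applied to the value, at a root of
    [g], of a lift of a factor of the reduction of [g], this contradicts any
    proper coprime factorization.

    Measurability ([P_set_section]). The product measure integrates over the
    constant coefficient first, so [P_set] is compared with preimages under
    reduction through its sections in that coefficient. The polynomials with a
    factorization of given degrees, the factors being allowed to be reducible,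
    form an open set among separable ones ([factor_sizes_open]), and a
    factorization is into irreducibles when no longer one exists; this makes
    each section a difference of two open sets. Openness is Hensel's lemma over
    the ring of integers of [K], whose completeness is derived from that of the
    p-adic numbers ([integers_complete]). *)

(** * Factorization of monic polynomials over a field *)

Section Factorization.
Variable L : fieldType.
Implicit Types (f g h : {poly L}) (gs hs : seq {poly L}).

Definition monic_irreducibles gs :=
  forall g, g \in gs -> g \is monic /\ irreducible_poly g.

Lemma monic_prod_seq gs : (forall g, g \in gs -> g \is monic) ->
  \prod_(g <- gs) g \is monic.
Proof. by move=> mon; rewrite big_seq; apply: monic_prod. Qed.

Lemma eqp_monicP f g : f \is monic -> g \is monic -> f %= g -> f = g.
Proof. by move=> mf mg; rewrite eqp_monic // => /eqP. Qed.

Lemma irreducible_coprimeVdvd g h :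
  irreducible_poly g -> coprimep g h \/ g %| h.
Proof.
move=> [sg irrg]; have [sz1|szN1] := eqVneq (size (gcdp g h)) 1%N.
  by left; rewrite /coprimep sz1.
by right; rewrite -(eqp_dvdl _ (irrg _ szN1 (dvdp_gcdl _ _))) dvdp_gcdr.
Qed.

Lemma irreducible_dvd_prod g hs : irreducible_poly g ->
  g %| \prod_(h <- hs) h -> exists2 h, h \in hs & g %| h.
Proof.
move=> irrg; elim: hs => [|h hs IH].
  by rewrite big_nil dvdp1 => /eqP sg; case: irrg; rewrite sg.
rewrite big_cons; case: (irreducible_coprimeVdvd h irrg) => [co|gh _].
  rewrite Gauss_dvdpr // => /IH[k kin gk]; exists k => //.
  by rewrite in_cons kin orbT.
by exists h; rewrite ?mem_head.
Qed.

Lemma monic_irreducible_dvd g h : g \is monic -> irreducible_poly g ->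
  h \is monic -> irreducible_poly h -> g %| h -> g = h.
Proof.
move=> mg [sg _] mh [_ irrh] gh; apply: eqp_monicP => //.
by apply: irrh => //; rewrite gtn_eqF.
Qed.

Lemma monic_irreducibles_unique gs hs :
  monic_irreducibles gs -> monic_irreducibles hs ->
  \prod_(g <- gs) g = \prod_(h <- hs) h -> perm_eq gs hs.
Proof.
elim: gs hs => [|g gs IH] hs igs ihs.
  case: hs ihs => // h hs ihs; rewrite big_nil big_cons => /esym/eqP.
  have [_ [sh _]] := ihs h (mem_head _ _).
  by move=> /eqP e; have := dvdp_mulr (\prod_(k <- hs) k) (dvdpp h);
     rewrite e dvdp1 gtn_eqF.
have [mg ig] := igs g (mem_head _ _).
rewrite big_cons => e.
have [|h hin gh] := @irreducible_dvd_prod g hs ig.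
  by rewrite -e dvdp_mulr.
have [mh ih] := ihs h hin.
move: hin; rewrite -(monic_irreducible_dvd mg ig mh ih gh) => {h gh mh ih} hin.
have phs := perm_to_rem hin.
rewrite perm_sym (perm_trans phs) // perm_cons perm_sym; apply: IH.
- by move=> k kin; apply: igs; rewrite in_cons kin orbT.
- by move=> k /mem_rem; apply: ihs.
apply: (mulfI (monic_neq0 mg)).
by rewrite e (perm_big _ phs) /= big_cons.
Qed.

Lemma monic_factorization f : f \is monic ->
  exists2 gs, monic_irreducibles gs & f = \prod_(g <- gs) g.
Proof.
elim/ltn_ind: {f}(size f) {-2}f (erefl (size f)) => m IH f szf mf.
have [sz1|szN1] := eqVneq (size f) 1%N.
  exists [::] => //; rewrite big_nil; apply/eqP.
  by rewrite -eqp_monic ?monic1 // -size_poly_eq1 sz1.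
have sf1 : (1 < size f)%N.
  by rewrite ltn_neqAle eq_sym szN1 size_poly_gt0 monic_neq0.
case: (pselect (irreducible_poly f)) => [irrf|nirr].
  by exists [:: f]; [move=> g; rewrite inE => /eqP -> | rewrite big_seq1].
have [g [gf sg ngf]] : exists g, [/\ g %| f, size g != 1%N & ~~ (g %= f)].
  apply/not_existsP => H; apply: nirr; split=> // q sq qf.
  by apply/negPn/negP => nq; apply: (H q).
have g0 : g != 0 by apply: contraTneq gf => ->; rewrite dvd0p monic_neq0.
pose a := (lead_coef g)^-1 *: g.
have ma : a \is monic.
  by rewrite monicE lead_coefZ mulVf // lead_coef_eq0.
have eqga : a %= g by rewrite eqp_scale // invr_eq0 lead_coef_eq0.
have fE : f = f %/ a * a by rewrite divpK // (eqp_dvdl _ eqga).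
have mb : f %/ a \is monic by move: mf; rewrite {1}fE monicMr.
have szE : size f = (size (f %/ a)%R + size a).-1.
  by rewrite {1}fE size_Mmonic ?monic_neq0.
have sa : size a = size g by apply: eqp_size.
have ga : (0 < size (f %/ a)%R)%N by rewrite size_poly_gt0 monic_neq0.
have gg : (1 < size g)%N by rewrite ltn_neqAle eq_sym sg size_poly_gt0.
have lgf : (size g < size f)%N.
  by rewrite ltn_neqAle (dvdp_leq (monic_neq0 mf)) // andbT dvdp_size_eqp.
have [as_ ias aE] := IH (size a) ltac:(by rewrite sa -szf) a erefl ma.
have lb : (size (f %/ a)%R < m)%N.
  by move: szE gg; rewrite -szf sa; case: (size g) => [|[|k]] // -> _;
    rewrite !addnS /= ltnS leq_addr.
have [bs ibs bE] := IH _ lb (f %/ a)%R erefl mb.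
exists (bs ++ as_); last by rewrite big_cat /= -bE -aE.
by move=> k; rewrite mem_cat => /orP[/ibs|/ias].
Qed.

Lemma sort_geq_perm (s t : seq nat) : perm_eq s t -> sort geq s = sort geq t.
Proof.
move=> /perm_sortP -> //.
- by move=> x y; apply: leq_total.
- by move=> x y z xy yz; apply: leq_trans yz xy.
by move=> x y; rewrite andbC -eqn_leq => /eqP.
Qed.

Lemma splitting_type_unique f mu mu' :
  has_splitting_type f mu -> has_splitting_type f mu' -> mu = mu'.
Proof.
move=> [gs [igs fg <-]] [hs [ihs fh <-]].
apply: sort_geq_perm; apply: perm_map.
by apply: monic_irreducibles_unique; rewrite -?fg.
Qed.

Lemma has_splitting_type_ex f : f \is monic -> exists mu, has_splitting_type f mu.
Proof.
by move=> /monic_factorization[gs igs fE]; eexists; exists gs; split.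
Qed.

Lemma square_free_dvd f g : square_free f -> g %| f -> square_free g.
Proof. by move=> sf gf h hg; apply: sf; apply: dvdp_trans gf. Qed.

Lemma square_free_coprime f g : square_free (f * g) -> coprimep f g.
Proof.
move=> sf; rewrite /coprimep; apply/eqP/sf.
by rewrite expr2 dvdp_mul // (dvdp_gcdl, dvdp_gcdr).
Qed.

Lemma coprime_deriv_square_free f : coprimep f f^`() -> square_free f.
Proof.
move=> co g g2; apply/eqP; rewrite -dvdp1.
have gf : g %| f by apply: dvdp_trans g2; rewrite expr2 dvdp_mulr.
have gf' : g %| f^`().
  have /dvdpP[q ->] := g2.
  rewrite expr2 !derivM; apply: dvdp_add; apply: dvdp_mull.
    exact: dvdp_mulr.
  by apply: dvdp_add; [exact: dvdp_mull | exact: dvdp_mulr].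
by have := co; rewrite /coprimep size_poly_eq1 => e; rewrite -(eqp_dvdr _ e) dvdp_gcd gf.
Qed.

End Factorization.

(** * Hensel's lemma *)

(** Applied to polynomials and a constant [d], this is divisibility of every
    coefficient ([rdvd_polyC]), so one notion serves for both congruences. *)
Definition rdvd (A : comNzRingType) (d x : A) := exists t, x = d * t.

Section RingDivisibility.
Variable A : comNzRingType.
Implicit Types d x y : A.

Lemma rdvd0 d : rdvd d 0. Proof. by exists 0; rewrite mulr0. Qed.

Lemma rdvdD d x y : rdvd d x -> rdvd d y -> rdvd d (x + y).
Proof. by move=> [s ->] [t ->]; exists (s + t); rewrite mulrDr. Qed.

Lemma rdvdN d x : rdvd d x -> rdvd d (- x).
Proof. by move=> [s ->]; exists (- s); rewrite mulrN. Qed.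

Lemma rdvdB d x y : rdvd d x -> rdvd d y -> rdvd d (x - y).
Proof. by move=> dx dy; apply: rdvdD => //; apply: rdvdN. Qed.

Lemma rdvd_mulr d x y : rdvd d x -> rdvd d (x * y).
Proof. by move=> [s ->]; exists (s * y); rewrite mulrA. Qed.

Lemma rdvd_mull d x y : rdvd d x -> rdvd d (y * x).
Proof. by rewrite mulrC; apply: rdvd_mulr. Qed.

Lemma rdvd_mul d e x y : rdvd d x -> rdvd e y -> rdvd (d * e) (x * y).
Proof. by move=> [s ->] [t ->]; exists (s * t); rewrite mulrACA. Qed.

Lemma rdvd_refl d : rdvd d d. Proof. by exists 1; rewrite mulr1. Qed.

Lemma rdvd_trans d e x : rdvd d e -> rdvd e x -> rdvd d x.
Proof. by move=> [s ->] [t ->]; exists (s * t); rewrite mulrA. Qed.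

Lemma rdvd_exp d m n : (m <= n)%N -> rdvd (d ^+ m) (d ^+ n).
Proof. by move=> /subnKC <-; exists (d ^+ (n - m)); rewrite exprD. Qed.

Lemma rdvd_polyC d (f : {poly A}) :
  rdvd d%:P f <-> forall i, rdvd d f`_i.
Proof.
split=> [[t ->] i|H]; first by exists t`_i; rewrite coefCM.
have [t tP] := choice H.
exists (\poly_(i < size f) t i); apply/polyP => i; rewrite coefCM coef_poly.
by case: ltnP => [_|/(nth_default 0) ->]; rewrite ?mulr0 // -tP.
Qed.

End RingDivisibility.

(** Cauchy sequences are given by their consecutive differences, the form in
    which successive approximation produces them. *)
Definition adic_complete (A : comNzRingType) (pi : A) :=
  forall u : nat -> A, (forall j, rdvd (pi ^+ j) (u j.+1 - u j)) ->
  exists l, forall j, rdvd (pi ^+ j) (l - u j).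

Definition adic_separated (A : comNzRingType) (pi : A) :=
  forall x : A, (forall j, rdvd (pi ^+ j) x) -> x = 0.

Section Hensel.
Variables (A : comNzRingType) (pi : A).
Hypotheses (cA : adic_complete pi) (sA : adic_separated pi).

Lemma adic_complete_poly n (u : nat -> {poly A}) :
  (forall j, (size (u j) <= n)%N) ->
  (forall j, rdvd (pi ^+ j)%:P (u j.+1 - u j)) ->
  exists2 l : {poly A}, (size l <= n)%N & forall j, rdvd (pi ^+ j)%:P (l - u j).
Proof.
move=> su du.
have H i : exists l, forall j, rdvd (pi ^+ j) (l - (u j)`_i).
  by apply: cA => j; move: (du j) => /rdvd_polyC/(_ i); rewrite coefB.
have [l lP] := choice H; exists (\poly_(i < n) l i); first exact: size_poly.
move=> j; apply/rdvd_polyC => i; rewrite coefB coef_poly.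
case: ltnP => // ni; rewrite [(u j)`_i]nth_default ?(leq_trans (su j)) //.
by rewrite subr0; apply: rdvd0.
Qed.

Lemma adic_separated_poly (f : {poly A}) :
  (forall j, rdvd (pi ^+ j)%:P f) -> f = 0.
Proof.
move=> H; apply/polyP => i; rewrite coef0; apply: sA => j.
by move: (H j) => /rdvd_polyC.
Qed.

Variables (g h : {poly A}) (c : nat) (U V : {poly A}).
Hypotheses (mg : g \is monic) (mh : h \is monic).
Hypothesis bezout : U * g + V * h = (pi ^+ c)%:P.

(** Reducing one cofactor modulo the monic [g] bounds its degree, and the degree
    of the right-hand side then bounds the other one. *)
Lemma bezout_degree (r : {poly A}) : (size r < size (g * h)%R)%N ->
  exists a b : {poly A}, [/\ (size a < size g)%N, (size b < size h)%N &
    g * b + h * a = (pi ^+ c)%:P * r].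
Proof.
move=> sr; pose a := Pdiv.Ring.rmodp (V * r) g.
pose b := U * r + h * Pdiv.Ring.rdivp (V * r) g.
have e : g * b + h * a = (pi ^+ c)%:P * r.
  have dE := Pdiv.RingMonic.rdivp_eq mg (V * r).
  rewrite -bezout mulrDl -[V * h * r]mulrAC dE /a /b; ring.
have sa : (size a < size g)%N by apply: Pdiv.Ring.ltn_rmodpN0; rewrite monic_neq0.
clearbody a b; exists a, b; split => //.
have [->|b0] := eqVneq b 0; first by rewrite size_poly0 size_poly_gt0 monic_neq0.
have h_gt0 : (0 < size h)%N by rewrite size_poly_gt0 monic_neq0.
have sgh : size (g * h)%R = (size g + size h).-1 by rewrite size_monicM ?monic_neq0.
have : (size (g * b)%R < size (g * h)%R)%N.
  rewrite (_ : g * b = (pi ^+ c)%:P * r - h * a); last by rewrite -e addrK.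
  apply: leq_ltn_trans (size_polyD _ _) _; rewrite size_polyN gtn_max; apply/andP; split.
    by rewrite mul_polyC (leq_ltn_trans (size_scale_leq _ _)).
  have [->|a0] := eqVneq a 0; first by rewrite mulr0 size_poly0 (leq_trans _ sr).
  rewrite sgh (size_monicM mh a0); move: sa h_gt0.
  by move: (size a) (size g) (size h); lia.
rewrite sgh (size_monicM mg b0); move: (size b) (size g) (size h); lia.
Qed.

Lemma size_monic_add (k a : {poly A}) : k \is monic -> (size a < size k)%N ->
  k + a \is monic /\ size (k + a)%R = size k.
Proof.
move=> mk sa; have sE := size_polyDl sa; split=> //.
by rewrite monicE lead_coefDl // (eqP mk).
Qed.

Let state j (ab : {poly A} * {poly A}) (f : {poly A}) :=
  [/\ (size ab.1 < size g)%N /\ (size ab.2 < size h)%N,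
      rdvd (pi ^+ c.+1)%:P ab.1, rdvd (pi ^+ c.+1)%:P ab.2 &
      rdvd (pi ^+ (c + c.+1 + j))%:P (f - (g + ab.1) * (h + ab.2))].

Lemma hensel_step (f : {poly A}) j ab :
  f \is monic -> size f = size (g * h)%R -> state j ab f ->
  exists ab', [/\ state j.+1 ab' f, rdvd (pi ^+ j)%:P (ab'.1 - ab.1) &
                  rdvd (pi ^+ j)%:P (ab'.2 - ab.2)].
Proof.
case: ab => a b /= mf sf [/= [sa sb] da db [r0 rE]].
have [mga sga] := size_monic_add mg sa.
have [mhb shb] := size_monic_add mh sb.
set err := f - _ in rE.
have szgh : (g + a) * (h + b) \is monic by rewrite monicMl.
have sgh : size ((g + a) * (h + b)) = size (g * h)%R.
  by rewrite !size_monicM ?monic_neq0 // sga shb.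
have gh1 : (0 < size (g * h)%R)%N by rewrite size_poly_gt0 monic_neq0 // monicMl.
have serr : (size err < size (g * h)%R)%N.
  rewrite -(prednK gh1) ltnS; apply/leq_sizeP => i hi.
  rewrite coefB; move: hi; rewrite leq_eqVlt => /predU1P[<-|hi].
    rewrite -{1}sf -sgh -!lead_coefE (monicP mf) (monicP szgh); exact: subrr.
  by rewrite !nth_default ?subrr // ?sgh ?sf -(prednK gh1).
(* Only the coefficients of [r0] below the degree of [g * h] matter, but the
   higher ones may be nonzero if [pi] is a zero divisor. *)
pose r := take_poly (size (g * h)%R).-1 r0.
have sr : (size r < size (g * h)%R)%N.
  by rewrite -(prednK gh1) ltnS size_take_poly.
have rE' : err = (pi ^+ (c + c.+1 + j))%:P * r.
  apply/polyP => i; rewrite coefCM coef_take_poly; case: ltnP => hi.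
    by rewrite rE coefCM.
  by rewrite mulr0 nth_default // (leq_trans _ hi) // -ltnS prednK.
have [s [t [ss st stE]]] := bezout_degree sr.
pose q := (pi ^+ (c.+1 + j))%:P : {poly A}.
have sq (k : {poly A}) : (size (q * k)%R <= size k)%N.
  by rewrite mul_polyC size_scale_leq.
have dq k : rdvd (pi ^+ j)%:P (q * k).
  by apply: rdvd_mulr; rewrite /q exprD polyCM; exact/rdvd_mull/rdvd_refl.
have dq1 k : rdvd (pi ^+ c.+1)%:P (q * k).
  by apply: rdvd_mulr; rewrite /q exprD polyCM; exact/rdvd_mulr/rdvd_refl.
exists (a + q * s, b + q * t) => /=; split; rewrite ?(addrC _ (q * _)) ?addrK //.
have size_add k (u v : {poly A}) : (size u < k)%N -> (size v < k)%N -> (size (u + v)%R < k)%N.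
  by move=> uk vk; rewrite (leq_ltn_trans (size_polyD _ _)) // gtn_max uk.
split=> /=; [split| | |].
- by apply: size_add => //; apply: leq_ltn_trans ss.
- by apply: size_add => //; apply: leq_ltn_trans st.
- exact: rdvdD.
- exact: rdvdD.
(* The terms linear in [s] and [t] cancel the error up to multiples of [a] and
   [b], which are divisible by [pi ^+ c.+1]. *)
have -> : f - (g + (q * s + a)) * (h + (q * t + b)) =
    - (a * q * t + b * q * s + q * q * (s * t)).
  have : err = q * (g * t + h * s).
    by rewrite rE' stE mulrA -polyCM /q -exprD; congr ((_ ^+ _)%:P * _); lia.
  rewrite /err => /(canRL (subrK _)) ->; ring.
have pE m n : (m <= n)%N -> rdvd (pi ^+ m)%:P (pi ^+ n)%:P.
  by move=> mn; rewrite !polyC_exp; apply: rdvd_exp.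
apply: rdvdN; apply: rdvdD; first apply: rdvdD.
- apply: rdvd_mulr; apply: (@rdvd_trans _ _ ((pi ^+ c.+1)%:P * q)).
    by rewrite -polyCM -exprD; apply: pE; lia.
  exact/rdvd_mul/rdvd_refl.
- apply: rdvd_mulr; apply: (@rdvd_trans _ _ ((pi ^+ c.+1)%:P * q)).
    by rewrite -polyCM -exprD; apply: pE; lia.
  exact/rdvd_mul/rdvd_refl.
apply: rdvd_mulr; rewrite -polyCM -exprD; apply: pE; lia.
Qed.

(** A linearly convergent iteration: the Bezout relation of [g] and [h] keeps
    serving as approximate inverse of the differential of the product map, the
    loss of [pi ^+ c] at each step being covered by the initial precision. *)
Lemma hensel (f : {poly A}) :
  f \is monic -> size f = size (g * h)%R ->
  rdvd (pi ^+ (c + c.+1))%:P (f - g * h) ->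
  exists g' h' : {poly A}, [/\ f = g' * h',
    g' \is monic /\ size g' = size g, h' \is monic /\ size h' = size h,
    rdvd (pi ^+ c.+1)%:P (g' - g) & rdvd (pi ^+ c.+1)%:P (h' - h)].
Proof.
move=> mf sf dfgh.
have [F FP] : exists F : nat -> {poly A} * {poly A} -> {poly A} * {poly A},
    forall j ab, state j ab f -> [/\ state j.+1 (F j ab) f,
      rdvd (pi ^+ j)%:P ((F j ab).1 - ab.1) & rdvd (pi ^+ j)%:P ((F j ab).2 - ab.2)].
  have H (x : nat * ({poly A} * {poly A})) : exists y, state x.1 x.2 f ->
      [/\ state x.1.+1 y f, rdvd (pi ^+ x.1)%:P (y.1 - x.2.1) &
          rdvd (pi ^+ x.1)%:P (y.2 - x.2.2)].
    case: (pselect (state x.1 x.2 f)) => [st|nst]; last by exists x.2.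
    by have [y yP] := hensel_step mf sf st; exists y.
  by have [F FP] := choice H; exists (fun j ab => F (j, ab)) => j ab /(FP (j, ab)).
pose fix u j := if j is k.+1 then F k (u k) else (0, 0).
have u_state j : state j (u j) f.
  elim: j => [|j IH /=]; last by case: (FP _ _ IH).
  split=> /=; rewrite ?size_poly0 ?size_poly_gt0 ?monic_neq0 ?addr0 ?addn0 //;
    exact: rdvd0.
have [a sa da] : exists2 a : {poly A}, (size a <= (size g).-1)%N &
    forall j, rdvd (pi ^+ j)%:P (a - (u j).1).
  apply: adic_complete_poly => j; last by case: (FP _ _ (u_state j)).
  by case: (u_state j) => [[]]; case: (size g).
have [b sb db] : exists2 b : {poly A}, (size b <= (size h).-1)%N &
    forall j, rdvd (pi ^+ j)%:P (b - (u j).2).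
  apply: adic_complete_poly => j; last by case: (FP _ _ (u_state j)).
  by case: (u_state j) => [[_]]; case: (size h).
have g_gt0 : (0 < size g)%N by rewrite size_poly_gt0 monic_neq0.
have h_gt0 : (0 < size h)%N by rewrite size_poly_gt0 monic_neq0.
have [mga sga] : g + a \is monic /\ size (g + a) = size g.
  by apply: size_monic_add; rewrite // -(prednK g_gt0) ltnS.
have [mhb shb] : h + b \is monic /\ size (h + b) = size h.
  by apply: size_monic_add; rewrite // -(prednK h_gt0) ltnS.
have near (d : {poly A}) (v : nat -> {poly A}) : (forall j, rdvd (pi ^+ j)%:P (d - v j)) ->
    (forall j, rdvd (pi ^+ c.+1)%:P (v j)) -> rdvd (pi ^+ c.+1)%:P d.
  move=> dv vc; rewrite -(subrK (v c.+1) d); exact: rdvdD.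
exists (g + a), (h + b); split=> //; rewrite ?(addrC _ a) ?(addrC _ b) ?addrK.
- apply/eqP; rewrite -subr_eq0; apply/eqP/adic_separated_poly => j.
  have -> : f - (a + g) * (b + h) = (f - (g + (u j).1) * (h + (u j).2))
      - (a - (u j).1) * (b + h) - (g + (u j).1) * (b - (u j).2) by ring.
  have [_ _ _ d] := u_state j.
  apply: rdvdB; first apply: rdvdB.
  + apply: rdvd_trans d; rewrite !polyC_exp; apply: rdvd_exp; exact: leq_addl.
  + exact: rdvd_mulr.
  + exact: rdvd_mull.
- by apply: near da _ => j; case: (u_state j).
- by apply: near db _ => j; case: (u_state j).
Qed.

End Hensel.

(** * Frobenius and the factorization of a split polynomial *)

Section Frobenius.
Variables (F L : finFieldType) (iota : {rmorphism F -> L}).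

(** [iota] is an argument because additivity relies on [L] containing [F]. *)
Definition frobenius of {rmorphism F -> L} := fun y : L => y ^+ #|F|.

Local Notation frob := (frobenius iota).

Fact frobenius_monoid_morphism : monoid_morphism frob.
Proof. by split=> [|x y]; rewrite /frobenius ?expr1n ?exprMn. Qed.

Fact frobenius_zmod_morphism : zmod_morphism frob.
Proof.
have [p p_pr pF] := finPcharP F.
have pL : p \in [pchar L] by apply: (rmorph_pchar iota).
have q_nat : [pchar L].-nat #|F|.
  by rewrite (card_pprimeChar pF) pnatX pnatE // pL.
move=> x y; rewrite /frobenius exprDn_pchar //; congr (_ + _).
apply/eqP; rewrite -addr_eq0 addrC; apply/eqP.
have := exprDn_pchar y (- y) q_nat; rewrite subrr expr0n.
by rewrite gtn_eqF ?(ltn_trans _ (finNzRing_gt1 F)).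
Qed.

HB.instance Definition _ := GRing.isZmodMorphism.Build L L frob frobenius_zmod_morphism.
HB.instance Definition _ := GRing.isMonoidMorphism.Build L L frob frobenius_monoid_morphism.

(** The elements of [F] already account for all roots of ['X^#|F| - 'X]. *)
Lemma frobenius_fixed y : frob y = y -> exists a, iota a = y.
Proof.
move=> fy; have : root (map_poly iota ('X^#|F| - 'X)) y.
  by rewrite rmorphB /= map_polyXn map_polyX /root !hornerE -[y ^+ _]/(frob y) fy subrr.
rewrite finField_genPoly rmorph_prod /= /root horner_prod.
under eq_bigr => a _ do rewrite rmorphB /= map_polyX map_polyC !hornerE.
by move=> /prodf_eq0[a _]; rewrite subr_eq0 => /eqP ->; exists a.
Qed.

Lemma frobenius_iota a : frob (iota a) = iota a.
Proof. by rewrite /frobenius -rmorphXn /= expf_card. Qed.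

Lemma frobenius_fixed_poly (g : {poly L}) :
  map_poly frob g = g -> exists h, map_poly iota h = g.
Proof.
move=> fg; have H i : exists a, iota a = g`_i.
  by apply: frobenius_fixed; rewrite -coef_map fg.
have [h hP] := choice H; exists (\poly_(i < size g) h i).
apply/polyP => i; rewrite coef_map coef_poly.
case: ltnP => [_|/(nth_default 0) ->]; [exact: hP | exact: rmorph0].
Qed.

Lemma frobenius_root (h : {poly F}) y :
  root (map_poly iota h) y -> root (map_poly iota h) (frob y).
Proof.
have e : map_poly frob (map_poly iota h) = map_poly iota h.
  by apply/polyP => i; rewrite !coef_map /= frobenius_iota.
by move=> ry; rewrite -e; apply: rmorph_root.
Qed.

End Frobenius.

Section CycleFactorization.
Variable T : finType.
Implicit Type s : {perm T}.

Lemma partition_porbits s : partition (porbits s) [set: T].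
Proof.
apply/and3P; split.
- rewrite eqEsubset subsetT; apply/subsetP => x _.
  by apply/bigcupP; exists (porbit s x); rewrite ?imset_f ?porbit_id.
- apply/trivIsetP => _ _ /imsetP[x _ ->] /imsetP[y _ ->] nxy.
  rewrite -setI_eq0; apply: contraNT nxy => /set0Pn[z] /setIP[zx zy].
    move: zx zy; rewrite -!eq_porbit_mem => /eqP <- /eqP <-; exact: eqxx.
apply/imsetP => -[x _ e]; have := porbit_id s x; by rewrite -e inE.
Qed.

Lemma sum_card_porbits s : (\sum_(c in porbits s) #|c|)%N = #|T|.
Proof. by rewrite -(card_partition (partition_porbits s)) cardsT. Qed.

End CycleFactorization.

Definition cycle_type n (s : 'S_n) : seq nat :=
  sort geq [seq #|c| | c : {set 'I_n} <- enum (porbits s)].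

Section SplittingTypeOfRoots.
Variables (F L : finFieldType) (iota : {rmorphism F -> L}) (n : nat).
Variables (x : 'I_n -> L) (f : {poly F}).
Hypothesis x_inj : injective x.
Hypothesis fE : map_poly iota f = \prod_i ('X - (x i)%:P).
Local Notation frob := (frobenius iota).

Lemma roots_frobenius : exists s : 'S_n, forall i, frob (x i) = x (s i).
Proof.
have rootE y : root (map_poly iota f) y -> exists j, y = x j.
  rewrite fE /root horner_prod => /prodf_eq0[j _].
  by rewrite !hornerE subr_eq0 => /eqP ->; exists j.
have H i : exists j, frob (x i) = x j.
  apply/rootE/frobenius_root; rewrite fE /root horner_prod; apply/prodf_eq0.
  by exists i; rewrite // !hornerE subrr.
have [s sP] := choice H.
have s_inj : injective s.
  by move=> i j e; apply: x_inj; apply: (fmorph_inj frob); apply: etrans (sP i) _; rewrite e -sP.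
by exists (perm s_inj) => i; rewrite permE.
Qed.

Variable s : 'S_n.
Hypothesis sE : forall i, frob (x i) = x (s i).

Let G (c : {set 'I_n}) : {poly L} := \prod_(i in c) ('X - (x i)%:P).

(** The product over a cycle of [s] is invariant under Frobenius, hence defined
    over [F]; a factor over [F] with one root in the cycle has all of them. *)
Lemma cycle_factor c : c \in porbits s ->
  exists g, [/\ map_poly iota g = G c, g \is monic, irreducible_poly g &
                (size g).-1 = #|c|].
Proof.
move=> /imsetP[i0 _ ->{c}]; set c := porbit s i0.
have sc i : i \in c -> s i \in c.
  rewrite /c -(eq_porbit_mem s i) => /eqP <-.
  by have := mem_porbit s 1 i; rewrite expg1.
have [g gE] : exists g, map_poly iota g = G c.
  apply: frobenius_fixed_poly; rewrite rmorph_prod /=.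
  have sCc : s @: c = c.
    apply/eqP; rewrite eqEcard card_imset ?leqnn ?andbT; last exact: perm_inj.
    by apply/subsetP => _ /imsetP[i ic ->]; apply: sc.
  rewrite /G -[in RHS]sCc big_imset /=; last by move=> ? ? _ _; apply: perm_inj.
  by apply: eq_bigr => i _; rewrite rmorphB /= map_polyX map_polyC /= sE.
have sG : size (G c) = #|c|.+1 by rewrite /G -big_enum size_prod_XsubC -cardE.
have mG : G c \is monic by apply: monic_prod_XsubC.
have sg : size g = #|c|.+1 by rewrite -sG -gE size_map_poly.
have mg : g \is monic by rewrite -(map_monic iota) gE.
exists g; split; rewrite ?sg //; split.
  by rewrite sg ltnS card_gt0; apply/set0Pn; exists i0; apply: porbit_id.
move=> h sh hg.
have /dvdp_prod_XsubC[m] : map_poly iota h %| \prod_(i <- enum c) ('X - (x i)%:P).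
  by rewrite big_enum /= -/(G c) -gE dvdp_map.
case E : (mask m (enum c)) => [|i r] hm.
  by move: hm; rewrite big_nil -size_poly_eq1 size_map_poly (negPf sh).
have ic : i \in c by rewrite -mem_enum (mem_mask (m := m)) // E mem_head.
have rt k : root (map_poly iota h) (x ((s ^+ k)%g i)).
  elim: k => [|k IH]; last by rewrite expgSr permM -sE frobenius_root.
  by rewrite expg0 perm1 (eqp_root hm) big_cons rootM root_XsubC eqxx.
have Gh : G c %| map_poly iota h.
  have -> : G c = \prod_(z <- [seq x j | j <- enum c]) ('X - z%:P).
    by rewrite big_map big_enum.
  apply: uniq_roots_dvdp; last by rewrite uniq_rootsE map_inj_uniq ?enum_uniq.
  apply/allP => _ /mapP[j jc ->]; move: jc; rewrite mem_enum => jc.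
  move: ic; rewrite /c -(eq_porbit_mem s i) => /eqP ic.
  move: jc; rewrite /c -ic => /porbitP[k ->]; apply: rt.
by rewrite /eqp hg -(dvdp_map iota) gE.
Qed.

Lemma splitting_type_of_roots : has_splitting_type f (cycle_type s).
Proof.
have H (c : {set 'I_n}) : exists g, c \in porbits s ->
    [/\ map_poly iota g = G c, g \is monic, irreducible_poly g & (size g).-1 = #|c|].
  case: (boolP (c \in porbits s)) => [/cycle_factor[g gP]|]; by [exists g | exists 0].
have [g gP] := choice H.
exists [seq g c | c <- enum (porbits s)]; split.
- by move=> _ /mapP[c cs ->]; rewrite mem_enum in cs; case: (gP _ cs).
- apply: (map_poly_inj iota); rewrite fE big_map big_enum rmorph_prod /=.
  rewrite (eq_bigl [in [set: 'I_n]]) => [|i]; last by rewrite in_setT.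
  rewrite (set_partition_big _ (partition_porbits s)) /=.
  by apply: eq_bigr => c cs; case: (gP _ cs).
congr sort; rewrite -map_comp; apply/eq_in_map => c.
by rewrite mem_enum => cs /=; case: (gP _ cs).
Qed.

End SplittingTypeOfRoots.

(** * Counting separable polynomials of given type over a finite field *)

Section MonicTuple.
Variables (A : comNzRingType) (n : nat).

(** Over the ring of integers this is [monic_of_tuple]; the general version is
    used for the reduction as well. *)
Definition monic_tuple (a : n.-tuple A) : {poly A} :=
  'X^n + \sum_(i < n) (tnth a i)%:P * 'X^i.

Lemma monic_tupleE a : monic_tuple a = 'X^n + \poly_(i < n) a`_i.
Proof.
by rewrite poly_def; congr (_ + _); apply: eq_bigr => i _; rewrite mul_polyC (tnth_nth 0).
Qed.

Lemma coef_monic_tuple a (i : 'I_n) : (monic_tuple a)`_i = tnth a i.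
Proof.
by rewrite monic_tupleE coefD coefXn coef_poly ltn_ord ltn_eqF // add0r (tnth_nth 0).
Qed.

Lemma size_monic_tuple a : size (monic_tuple a) = n.+1.
Proof. by rewrite monic_tupleE size_polyDl size_polyXn // ltnS size_poly. Qed.

Lemma monic_monic_tuple a : monic_tuple a \is monic.
Proof.
rewrite monicE monic_tupleE lead_coefDl ?lead_coefXn //.
by rewrite size_polyXn ltnS size_poly.
Qed.

Lemma monic_tuple_inj : injective monic_tuple.
Proof. by move=> a b e; apply: eq_from_tnth => i; rewrite -!coef_monic_tuple e. Qed.

End MonicTuple.

Lemma map_monic_tuple (A B : comNzRingType) (phi : {rmorphism A -> B}) n
    (a : n.-tuple A) :
  map_poly phi (monic_tuple a) = monic_tuple [tuple of map phi a].
Proof.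
rewrite /monic_tuple rmorphD /= map_polyXn rmorph_sum; congr (_ + _).
by apply: eq_bigr => i _; rewrite rmorphM /= map_polyC map_polyXn tnth_map.
Qed.

Section CountRoots.
Variables (F L : finFieldType).
Local Notation q := #|F|.

Lemma card_fixed_points d : (0 < d)%N ->
  (#|[pred y : L | y ^+ (q ^ d) == y]| <= q ^ d)%N.
Proof.
move=> d0; have q1 := finNzRing_gt1 F.
have qd1 : (1 < q ^ d)%N by rewrite -(exp1n d) ltn_exp2r.
have szP : size ('X^(q ^ d) - 'X : {poly L}) = (q ^ d).+1.
  by rewrite size_polyDl ?size_polyXn // size_polyN size_polyX.
rewrite cardE -ltnS -szP; apply: max_poly_roots; rewrite ?enum_uniq //.
  by rewrite -size_poly_gt0 szP.
by apply/allP => y; rewrite mem_enum inE /root !hornerE subr_eq0.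
Qed.

(** A solution is determined by its values at one representative of each cycle
    of [s], and the value at a cycle of length [d] is fixed by the [d]-th power
    of Frobenius. *)
Lemma card_frobenius_solutions n (s : 'S_n) :
  (#|[set x : {ffun 'I_n -> L} | [forall i, x i ^+ q == x (s i)]]| <= q ^ n)%N.
Proof.
set X := [set _ | _].
have XP (x : {ffun 'I_n -> L}) k i : x \in X -> x i ^+ (q ^ k) = x ((s ^+ k)%g i).
  rewrite inE => /forallP xs; elim: k => [|k IH]; first by rewrite expg0 perm1.
  by rewrite expnSr exprM IH (eqP (xs _)) expgSr permM.
pose phi (x : {ffun 'I_n -> L}) : {ffun {set 'I_n} -> L} :=
  [ffun c : {set 'I_n} => if c \in porbits s then
     (if [pick i in c] is Some i then x i else 0) else 0].
have phi_inj : {in X &, injective phi}.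
  move=> x y xX yX /ffunP e; apply/ffunP => j.
  have := e (porbit s j); rewrite !ffunE imset_f //.
  case: pickP => [i|/(_ j)]; last by rewrite porbit_id.
  rewrite porbit_sym => /porbitP[k ->] exy.
  by rewrite -!XP // exy.
rewrite -(card_in_imset phi_inj).
pose fam := pfamily 0 (mem (porbits s)) (fun c : {set 'I_n} => [pred y : L | y ^+ (q ^ #|c|) == y]).
have sub : phi @: X \subset fam.
  apply/subsetP => _ /imsetP[x xX ->]; apply/pfamilyP; split.
    by apply/supportP => c; rewrite ffunE => /negPf ->.
  move=> _ /imsetP[j _ ->]; rewrite ffunE imset_f //.
  case: pickP => [i|/(_ j)]; last by rewrite porbit_id.
  by rewrite -eq_porbit_mem => /eqP <-; rewrite inE XP // permX iter_porbit.
apply: leq_trans (subset_leq_card sub) _; rewrite card_pfamily.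
rewrite -[X in (_ <= _ ^ X)%N]card_ord -(sum_card_porbits s) expn_sum.
rewrite foldrE big_map big_enum /=; apply: leq_prod => c /imsetP[j _ ->].
by apply: card_fixed_points; rewrite card_gt0; apply/set0Pn; exists j; apply: porbit_id.
Qed.

End CountRoots.

(** Splitting field of the product of the finitely many monic polynomials of
    degree [n]. *)
Lemma common_splitting_field (F : finFieldType) n :
  exists (L : finFieldType) (iota : {rmorphism F -> L}),
    forall t : n.-tuple F, exists x : 'I_n -> L,
      map_poly iota (monic_tuple t) = \prod_i ('X - (x i)%:P).
Proof.
pose P := \prod_(t : n.-tuple F) monic_tuple t.
have P0 : P != 0 by apply/monic_neq0/monic_prod => t _; apply: monic_monic_tuple.
have [L [rs Prs _]] := FinSplittingFieldFor P0.
exists (finvect_type L), (in_alg L : {rmorphism F -> L}) => t.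
set f := map_poly _ _.
have : f %| \prod_(z <- rs) ('X - z%:P).
  rewrite -(eqp_dvdr _ Prs) dvdp_map /P (bigD1 t) //=; exact: dvdp_mulr.
move=> /dvdp_prod_XsubC[m]; rewrite eqp_monic ?monic_prod_XsubC ?map_monic ?monic_monic_tuple //.
move=> /eqP fE.
have szm : size (mask m rs) == n.
  have := congr1 (size \o polyseq) fE.
  by rewrite /= size_prod_XsubC size_map_poly size_monic_tuple => -[->].
exists (tnth (Tuple szm)); rewrite fE.
exact: (big_tuple _ _ (Tuple szm) xpredT (fun z => 'X - z%:P)).
Qed.

(** Pairs of a polynomial in [A] and an ordering of its roots inject into the
    solutions [x] of [x i ^+ q = x (s i)] with [s] in [C]: Frobenius permutes the
    ordered roots by a permutation [s] whose cycle type is the splitting type. *)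
Lemma card_separable_le (F : finFieldType) n (A : {set n.-tuple F}) (C : {set 'S_n}) :
  (forall t, t \in A -> separable_poly (monic_tuple t)) ->
  (forall t s, t \in A -> has_splitting_type (monic_tuple t) (cycle_type s) -> s \in C) ->
  (n`! * #|A| <= #|C| * #|F| ^ n)%N.
Proof.
move=> sepA typA.
have [L [iota /choice[x xE]]] := common_splitting_field F n.
have x_inj t : t \in A -> injective (x t).
  move=> /sepA; rewrite -(separable_map iota) xE.
  have -> : \prod_i ('X - (x t i)%:P) = \prod_(z <- [seq x t i | i in 'I_n]) ('X - z%:P).
    by rewrite big_image.
  by rewrite separable_prod_XsubC => u; apply/injectiveP.
pose phi (ts : n.-tuple F * 'S_n) : {ffun 'I_n -> L} := [ffun i => x ts.1 (ts.2 i)].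
pose D := setX A [set: 'S_n].
pose X (s : 'S_n) : {set {ffun 'I_n -> L}} :=
  [set y : {ffun 'I_n -> L} | [forall i, y i ^+ #|F| == y (s i)]].
have phiE ts : map_poly iota (monic_tuple ts.1) = \prod_i ('X - (phi ts i)%:P).
  rewrite xE (reindex_inj (@perm_inj _ ts.2)) /=.
  by apply: eq_bigr => i _; rewrite ffunE.
have phi_inj : {in D &, injective phi}.
  move=> [t s] [t' s']; rewrite !inE !andbT /= => tA tA' e.
  have tt : t = t'.
    by apply/monic_tuple_inj/(map_poly_inj iota); rewrite (phiE (t, s)) (phiE (t', s')) e.
  case: _ / tt e => e; congr (_, _); apply/permP => i; apply: (x_inj t tA).
  by have /ffunP/(_ i) := e; rewrite !ffunE.
have sub : phi @: D \subset \bigcup_(s in C) X s.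
  apply/subsetP => _ /imsetP[[t s] ts ->]; move: ts; rewrite !inE andbT /= => tA.
  have inj : injective (phi (t, s)) by move=> i j; rewrite !ffunE => /x_inj-/(_ tA)/perm_inj.
  have [r rE] := roots_frobenius inj (phiE (t, s)).
  apply/bigcupP; exists r; first exact: (typA t) tA (splitting_type_of_roots inj (phiE (t, s)) rE).
  by rewrite inE; apply/forallP => i; rewrite -rE.
have := subset_leq_card sub; rewrite (card_in_imset phi_inj) cardsX cardsT card_Sn mulnC.
move=> /leq_trans; apply.
have le1 : (#|\bigcup_(s in C) X s| <= \sum_(s in C) #|X s|)%N.
  elim/big_rec2: _ => [|s m Y _ le]; first by rewrite cards0.
  by apply: leq_trans (leq_card_setU _ _) _; rewrite leq_add2l.
apply: leq_trans le1 _.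
rewrite -sum_nat_const; apply: leq_sum => s _; exact: card_frobenius_solutions.
Qed.

Lemma size_monic_factors (L : fieldType) (gs : seq {poly L}) :
  (forall g, g \in gs -> g \is monic) -> (forall g, g \in gs -> (1 < size g)%N) ->
  (size gs < size (\prod_(g <- gs) g)%R)%N.
Proof.
elim: gs => [|g gs IH] mon sz; first by rewrite big_nil size_poly1.
have mg := mon g (mem_head _ _); have sg := sz g (mem_head _ _).
have mon' h : h \in gs -> h \is monic by move=> hin; apply: mon; rewrite inE hin orbT.
have := IH mon' (fun h hin => sz h (mem_behead (hin : h \in behead (g :: gs)))).
rewrite big_cons; set P : {poly L} := \prod_(h <- gs) h => IHP.
rewrite (size_monicM mg) ?(monic_neq0 (monic_prod_seq mon')) //=.
by move: sg IHP; move: (size g) (size P); lia.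
Qed.

(** A translate [f + a] is inseparable only if one of the irreducible factors of
    [f'] divides it, and a given factor divides at most one translate. *)
Lemma card_inseparable_translates (F : finFieldType) (f : {poly F}) : f^`() != 0 ->
  (#|[set a : F | ~~ separable_poly (f + a%:P)]| <= (size f^`()).-1)%N.
Proof.
move=> d0; set S := [set _ | _]; set d := f^`().
pose e := (lead_coef d)^-1 *: d.
have me : e \is monic by rewrite monicE lead_coefZ mulVf ?lead_coef_eq0.
have ed : e %= d by rewrite eqp_scale // invr_eq0 lead_coef_eq0.
have [gs igs eE] := monic_factorization me.
have H a : exists g, a \in S -> g \in gs /\ g %| f + a%:P.
  case: (boolP (a \in S)) => [|_]; last by exists 0.
  rewrite inE unlock derivD derivC addr0 -/d -(eqp_coprimepr _ ed) => nco.
  suff [g [gin ga]] : exists g, g \in gs /\ g %| f + a%:P by exists g.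
  apply: contrapT => /forallNP H; move/negP: nco; apply.
  rewrite eE coprimep_sym big_seq.
  apply: (big_ind (fun h => coprimep h (f + a%:P))) => [|x y cx cy|g gin].
  - exact: coprime1p.
  - by rewrite coprimepMl cx.
  by case: (irreducible_coprimeVdvd (f + a%:P) (igs g gin).2) => // ga; case: (H g).
have [g gP] := choice H.
have g_inj : {in S &, injective g}.
  move=> a b aS bS eab; have [gin ga] := gP a aS; have [_ gb] := gP b bS.
  have : g a %| (a - b)%:P.
    have -> : (a - b)%:P = (f + a%:P) - (f + b%:P) by rewrite polyCB; ring.
    by rewrite dvdp_sub // eab.
  apply: contraTeq => nab; have [_ [sg _]] := igs _ gin.
  rewrite gtNdvdp ?polyC_eq0 ?subr_eq0 //.
  by rewrite size_polyC subr_eq0 nab.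
have le : (#|S| <= size gs)%N.
  rewrite cardE -(size_map g); apply: uniq_leq_size.
    rewrite map_inj_in_uniq ?enum_uniq // => a b; rewrite !mem_enum; exact: g_inj.
  by move=> _ /mapP[a aS ->]; rewrite mem_enum in aS; case: (gP a aS).
apply: leq_trans le _; rewrite -ltnS prednK ?size_poly_gt0 //.
rewrite -(eqp_size ed) eE; apply: size_monic_factors => h /igs[]//.
by move=> _ [].
Qed.

Lemma monic_tuple_cons (A : comNzRingType) n (a : A) (w : n.-tuple A) :
  monic_tuple [tuple of a :: w] = 'X * monic_tuple w + a%:P.
Proof.
rewrite /monic_tuple big_ord_recl expr0 mulr1 mulrDr -exprS tnth0.
rewrite addrCA addrC; congr (_ + _ + _); rewrite mulr_sumr.
by apply: eq_bigr => i _; rewrite tnthS exprS /=; ring.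
Qed.

(** For given nonconstant coefficients, [card_inseparable_translates] bounds the
    number of bad constant coefficients, unless the derivative vanishes; this
    forces the linear coefficient to be 0, which leaves [q ^ n.-1] tuples. *)
Lemma card_inseparable (F : finFieldType) n : (2 <= n)%N ->
  (#|[set t : n.-tuple F | ~~ separable_poly (monic_tuple t)]| <= n * #|F| ^ n.-1)%N.
Proof.
case: n => [|[|m]] // _; set N := [set _ | _].
pose bad (w : m.+1.-tuple F) :=
  [set a : F | ~~ separable_poly ('X * monic_tuple w + a%:P)].
have -> : (#|N| = \sum_(w : m.+1.-tuple F) #|bad w|)%N.
  rewrite -sum1_card (partition_big (@behead_tuple _ _) xpredT) //=.
  apply: eq_bigr => w _; rewrite sum1dep_card.
  have inj : injective (fun a => [tuple of a :: w]) by move=> a b /(congr1 val)[].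
  rewrite -(card_imset _ inj); apply: eq_card => t; rewrite inE; apply/andP/imsetP.
    move=> [tN /eqP tw]; exists (thead t); last by rewrite -tw -tuple_eta.
    by rewrite inE -monic_tuple_cons -tw -tuple_eta; rewrite inE in tN.
  move=> [a]; rewrite inE -monic_tuple_cons => ha ->; rewrite inE; split=> //.
  by apply/eqP/val_inj.
pose Z := [set w : m.+1.-tuple F | thead w == 0].
have cZ : (#|Z| <= #|F| ^ m)%N.
  rewrite -card_tuple -(@card_in_imset _ _ (@behead_tuple _ _)) ?max_card //.
  move=> v w; rewrite !inE => /eqP v0 /eqP w0 e.
  rewrite [LHS]tuple_eta [RHS]tuple_eta v0 w0; apply: val_inj => /=.
  by have := congr1 val e => /= ->.
rewrite (bigID [in Z]) /=.
have le1 : (\sum_(w in Z) #|bad w| <= #|F| ^ m.+1)%N.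
  apply: (@leq_trans (\sum_(w in Z) #|F|)%N); first by apply: leq_sum => w _; apply: max_card.
  by rewrite sum_nat_const expnSr leq_mul2r cZ orbT.
have le2 : (\sum_(w | w \notin Z) #|bad w| <= m.+1 * #|F| ^ m.+1)%N.
  apply: (@leq_trans (\sum_(w : m.+1.-tuple F | w \notin Z) m.+1)%N); last first.
    rewrite sum_nat_const mulnC leq_mul2l -card_tuple; exact/orP/or_intror/max_card.
  apply: leq_sum => w; rewrite inE => w0.
  have d1 : ('X * monic_tuple w)^`()`_0 = thead w.
    by rewrite coef_deriv mulr1n coefXM /= /thead -coef_monic_tuple.
  apply: leq_trans (card_inseparable_translates _) _.
    by apply: contraNneq w0 => d0; rewrite -d1 d0 coef0.
  have sX : size ('X * monic_tuple w) = m.+3.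
    by rewrite mulrC size_mulX ?size_monic_tuple ?monic_neq0 ?monic_monic_tuple.
  have := @lt_size_deriv _ ('X * monic_tuple w); rewrite -size_poly_gt0 sX.
  by case: size => // k /(_ isT).
by rewrite mulSn leq_add.
Qed.

Section CountSplittingType.
Variables (F : finFieldType) (n : nat) (mu : seq nat).

Definition separable_of_type : {set n.-tuple F} :=
  [set t | separable_poly (monic_tuple t) &&
           `[< has_splitting_type (monic_tuple t) mu >]].

Definition inseparable : {set n.-tuple F} :=
  [set t | ~~ separable_poly (monic_tuple t)].

Lemma card_separable_of_type_le :
  (n`! * #|separable_of_type| <= #|cycle_class n mu| * #|F| ^ n)%N.
Proof.
apply: card_separable_le => [t|t s]; rewrite inE => /andP[] // _ /asboolP ht hs.
by rewrite inE; apply/eqP/(splitting_type_unique hs ht).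
Qed.

(** The upper bound applied to all other splitting types together leaves room
    for a lower bound, since there are [q ^ n] monic polynomials in total. *)
Lemma card_separable_of_type_ge :
  (#|cycle_class n mu| * #|F| ^ n <= n`! * (#|separable_of_type| + #|inseparable|))%N.
Proof.
pose A := ~: (separable_of_type :|: inseparable).
have leA : (n`! * #|A| <= #|~: cycle_class n mu| * #|F| ^ n)%N.
  apply: card_separable_le => [t|t s]; rewrite !inE negb_or negbK andbC.
    by case/andP.
  move=> /andP[->] /=; move=> /asboolPn nt hs; apply/eqP => e; apply: nt.
  by rewrite -e.
have cardC : (#|cycle_class n mu| + #|~: cycle_class n mu| = n`!)%N.
  by rewrite cardsC card_Sn.
have cardA : (#|F| ^ n <= #|separable_of_type| + #|inseparable| + #|A|)%N.
  rewrite -{1}(card_tuple n F) -cardsT.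
  rewrite -[in leqLHS](setUCr (separable_of_type :|: inseparable)) -/A.
  by apply: leq_trans (leq_card_setU _ _) _; rewrite leq_add2r leq_card_setU.
rewrite -(leq_add2r (n`! * #|A|)) -mulnDr.
apply: leq_trans (_ : n`! * #|F| ^ n <= _)%N; last by rewrite leq_mul2l cardA orbT.
by rewrite -[X in (_ <= X * _)%N]cardC mulnDl leq_add2l.
Qed.

End CountSplittingType.

(** * The p-adic integers *)

Lemma exp_inv_lt (R : realType) p (e : R) : (1 < p)%N -> 0 < e -> exists k, p%:R ^- k < e.
Proof.
move=> p1 e0; have ei : 0 < e^-1 by rewrite invr_gt0.
have p0 : (0 : R) < p%:R by rewrite ltr0n ltnW.
exists (Num.bound e^-1); rewrite -[ltRHS]invrK ltf_pV2 ?posrE ?exprn_gt0 //.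
apply: lt_le_trans (archi_boundP (ltW ei)) _.
by rewrite -natrX ler_nat ltnW // ltn_expl.
Qed.

Section Padic.
Variables (R : realType) (p : nat) (Q : padic_numbers R p).
Hypothesis p_pr : prime p.
Implicit Types x y : Q.
Local Notation abs := (@Qp_abs R p Q).
Local Notation pz := (p%:R : Defs.Zp Q).

Lemma Qp_absN x : abs (- x) = abs x.
Proof. by rewrite -mulN1r Qp_absM Qp_absN1 mul1r. Qed.

Lemma Qp_abs0 : abs 0 = 0.
Proof. by have := Qp_abs_rat Q 0; rewrite /ratr divr1 => ->; rewrite /rat_padic_abs eqxx. Qed.

Lemma Qp_abs_ge0 x : 0 <= abs x.
Proof. by have := Qp_absD x (- x); rewrite subrr Qp_absN maxxx Qp_abs0. Qed.

Lemma Qp_abs_gt0 x : x != 0 -> 0 < abs x.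
Proof.
rewrite lt0r Qp_abs_ge0 andbT; apply: contraNneq => /Qp_abs_eq0 ->; exact: eqxx.
Qed.

Lemma Qp_absB_le x y e : abs x <= e -> abs y <= e -> abs (x - y) <= e.
Proof. by move=> xe ye; rewrite (le_trans (Qp_absD _ _)) // Qp_absN ge_max xe. Qed.

Lemma Qp_absX x k : abs (x ^+ k) = abs x ^+ k.
Proof.
by elim: k => [|k IH]; rewrite ?expr0 ?Qp_abs1 // !exprS Qp_absM IH.
Qed.

Lemma Qp_abs_p : abs p%:R = p%:R^-1.
Proof.
have := Qp_abs_rat Q p%:Z%:~R.
rewrite /ratr numq_int denq_int divr1 -pmulrn => ->; rewrite /rat_padic_abs.
rewrite intr_eq0 eqz_nat gtn_eqF ?prime_gt0 // numq_int denq_int logn1 expr0.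
by rewrite absz_nat lognE p_pr dvdnn prime_gt0 //= divnn prime_gt0 // logn1 expr1 div1r.
Qed.

Lemma p_neq0 : (p%:R : Q) != 0.
Proof.
apply/eqP => e; have /esym/eqP := Qp_abs_p; rewrite e Qp_abs0 invr_eq0 pnatr_eq0.
by rewrite gtn_eqF ?prime_gt0.
Qed.

Lemma Qp_abs_pX k : abs (p%:R ^+ k) = p%:R ^- k.
Proof. by rewrite Qp_absX Qp_abs_p exprVn. Qed.

(** The value group is that of the rationals, by density. *)
Lemma Qp_abs_lt1 x : abs x < 1 -> abs x <= p%:R^-1.
Proof.
have [->|x0] := eqVneq x 0; first by rewrite Qp_abs0 invr_ge0.
move=> x1; have ax := Qp_abs_gt0 x0; have [r xr] := Qp_dense x ax.
have rx : abs (ratr r) = abs x.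
  apply/eqP; rewrite eq_le; apply/andP; split.
    by rewrite -[ratr r](subKr x) Qp_absB_le // ltW.
  have := Qp_absD (ratr r) (x - ratr r); rewrite addrC subrK le_max.
  by rewrite [X in _ || X]leNgt xr orbF.
move: x1; rewrite -rx Qp_abs_rat /rat_padic_abs; case: ifP => [_ _|_].
  by rewrite invr_ge0.
have p0 : (0 : R) < p%:R by rewrite ltr0n prime_gt0.
rewrite ltr_pdivrMr ?exprn_gt0 // mul1r ler_pdivrMr ?exprn_gt0 //.
rewrite mulrC ler_pdivlMr // -exprSr.
by rewrite ltr_eXn2l ?ler_eXn2l ?ltr1n ?prime_gt1.
Qed.

Lemma Zp_abs_le1 (x : Defs.Zp Q) : abs (\val x) <= 1.
Proof. exact: valP x. Qed.

Lemma rdvd_Zp k (x : Defs.Zp Q) : rdvd (pz ^+ k) x <-> abs (val x) <= p%:R ^- k.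
Proof.
have valp : val (pz ^+ k) = p%:R ^+ k by rewrite rmorphXn; congr (_ ^+ _); apply: rmorph_nat.
split=> [[t ->]|xk].
  by rewrite rmorphM /= valp Qp_absM Qp_abs_pX ler_piMr ?Zp_abs_le1 // invr_ge0 exprn_ge0.
have yP : (p%:R ^- k * val x) \in @in_Zp _ _ Q.
  rewrite unfold_in Qp_absM -exprVn Qp_absX.
  have -> : abs p%:R^-1 = p%:R.
    have := Qp_absM (p%:R) (p%:R^-1 : Q); rewrite divff ?p_neq0 // Qp_abs1 Qp_abs_p.
    move=> /esym/(canRL (mulKf _)) ->; rewrite ?invrK ?mulr1 // invr_neq0 //.
    by rewrite pnatr_eq0 gtn_eqF ?prime_gt0.
  by rewrite mulrC -ler_pdivlMr ?exprn_gt0 ?ltr0n ?prime_gt0 // mul1r.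
exists (MkZp yP); apply: val_inj; rewrite rmorphM /= valp mulVKf //.
by rewrite expf_neq0 // p_neq0.
Qed.

Lemma Zp_separated : adic_separated pz.
Proof.
move=> x H; apply: val_inj; apply: Qp_abs_eq0.
apply/eqP; rewrite eq_le Qp_abs_ge0 andbT; apply/ler_addgt0Pr => e e0.
have [k ke] := exp_inv_lt (prime_gt1 p_pr) e0.
by rewrite add0r; apply: le_trans (ltW ke); apply/rdvd_Zp.
Qed.

Lemma Qp_complete_geometric (C : R) (u : nat -> Q) : 0 < C ->
  (forall j, abs (u j.+1 - u j) <= C * p%:R ^- j) ->
  exists l, forall j, abs (l - u j) <= C * p%:R ^- j.
Proof.
move=> C0 du; have p0 : (0 : R) < p%:R by rewrite ltr0n prime_gt0.
have p1 : (1 : R) < p%:R by rewrite ltr1n prime_gt1.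
have cauchy j i : (j <= i)%N -> abs (u i - u j) <= C * p%:R ^- j.
  move=> /subnKC <-; elim: (i - j)%N => [|k IH].
    by rewrite addn0 subrr Qp_abs0 mulr_ge0 ?ltW // invr_gt0 exprn_gt0.
  rewrite addnS -(subrK (u (j + k)%N) (u _)) -addrA (le_trans (Qp_absD _ _)) //.
  rewrite ge_max IH andbT (le_trans (du _)) // ler_pM2l // lef_pV2 ?posrE ?exprn_gt0 //.
  by rewrite ler_eXn2l // leq_addr.
have small e : 0 < e -> exists k, C * p%:R ^- k < e.
  move=> e0; have [k ke] := exp_inv_lt (prime_gt1 p_pr) (divr_gt0 e0 C0).
  by exists k; rewrite mulrC -ltr_pdivlMr.
have [|l lP] := @Qp_complete _ _ Q u.
  move=> e /small[k ke]; exists k => i j ki kj.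
  apply: le_lt_trans ke.
  have -> : u i - u j = (u i - u k) - (u j - u k) by rewrite opprB addrA subrK.
  by apply: Qp_absB_le; apply: cauchy.
exists l => j.
have e0 : 0 < C * p%:R ^- j by rewrite mulr_gt0 // invr_gt0 exprn_gt0.
have [N NP] := lP _ e0.
pose m := maxn N j.
have -> : l - u j = (u m - u j) - (u m - l) by rewrite opprB [RHS]addrC addrA subrK.
apply: Qp_absB_le; first by apply: cauchy; rewrite leq_maxr.
by apply/ltW/NP; rewrite leq_maxl.
Qed.

Lemma Zp_complete : adic_complete pz.
Proof.
move=> u du.
have [|l lP] := @Qp_complete_geometric 1 (fun j => val (u j)) ltr01.
  by move=> j; rewrite mul1r -rmorphB; apply/rdvd_Zp.
have lZ : l \in @in_Zp _ _ Q.
  rewrite unfold_in -(subrK (val (u 0%N)) l) (le_trans (Qp_absD _ _)) //.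
  by rewrite ge_max Zp_abs_le1 andbT (le_trans (lP 0%N)) // mul1r expr0 invr1.
by exists (MkZp lZ) => j; apply/rdvd_Zp; rewrite rmorphB -[X in _ <= X]mul1r; apply: lP.
Qed.

Lemma Zp_unit (x : Defs.Zp Q) : ~ rdvd pz x -> exists y : Defs.Zp Q, y * x = 1.
Proof.
move=> nx; have ax : abs (val x) = 1.
  apply/eqP; rewrite eq_le Zp_abs_le1 /= leNgt; apply/negP => /Qp_abs_lt1 lx.
  by apply: nx; rewrite -[pz]expr1; apply/rdvd_Zp; rewrite expr1.
have x0 : val x != 0.
  by apply/eqP => e; move/eqP: ax; rewrite e Qp_abs0 eq_sym oner_eq0.
have yZ : (val x)^-1 \in @in_Zp _ _ Q.
  rewrite unfold_in; have := Qp_absM (val x) (val x)^-1.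
  by rewrite divff // Qp_abs1 ax mul1r => <-.
exists (MkZp yZ); apply: val_inj; exact: mulVf.
Qed.

Lemma Zp_p_nonunit : ~ rdvd pz 1.
Proof.
rewrite -[pz]expr1 => /rdvd_Zp; rewrite expr1.
have -> : val (1 : Defs.Zp Q) = 1 by [].
by rewrite Qp_abs1 leNgt invf_lt1 ?ltr1n ?prime_gt1 // ltr0n prime_gt0.
Qed.

(** Modulo [p] the equation [P] of [x] is ['X^i * W] with [W.[0]] a unit. By
    Hensel's lemma [P] itself factors accordingly, and [x] is a root of one of
    the two factors: of the lift of [W] in the first case, where [x] is
    invertible modulo [p], and of the lift of ['X^i] in the second. *)
Lemma integral_unit_or_nilpotent (L : fieldType) (phi : {rmorphism Defs.Zp Q -> L}) (x : L) :
  integralOver phi x ->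
  (exists u t, 1 = x * (map_poly phi u).[x] + p%:R * (map_poly phi t).[x]) \/
  (exists i t, x ^+ i = p%:R * (map_poly phi t).[x]).
Proof.
move=> [P mP rP].
have exi : exists i, `[< ~ rdvd pz P`_i >].
  exists (size P).-1; apply/asboolP; rewrite -lead_coefE (monicP mP).
  exact: Zp_p_nonunit.
pose i := ex_minn exi.
have [/asboolP Pi minP] : `[< ~ rdvd pz P`_i >] /\
    forall j, `[< ~ rdvd pz P`_j >] -> (i <= j)%N.
  by rewrite /i; case: ex_minnP.
clearbody i; have isz : (i < size P)%N.
  by rewrite ltnNge; apply/negP => le; apply: Pi; rewrite nth_default //; apply: rdvd0.
pose W := drop_poly i P.
have PE : P = take_poly i P + 'X^i * W by rewrite [_ * W]mulrC poly_take_drop.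
have szW : size W = (size P - i)%N by rewrite size_drop_poly.
have mW : W \is monic.
  rewrite monicE lead_coefE szW coef_drop_poly -(monicP mP) lead_coefE.
  by apply/eqP; congr nth; move: isz; move: (size P); lia.
have W0 : W`_0 = P`_i by rewrite coef_drop_poly add0n.
have [w wE] := Zp_unit Pi.
(* [W] is a unit modulo ['X], hence modulo ['X^i] by a geometric series. *)
pose s := - (w%:P * drop_poly 1 W).
have WE : w%:P * W = 1 - 'X * s.
  rewrite -{1}(poly_take_drop 1 W) mulrDr; congr (_ + _); last first.
    by rewrite expr1 /s mulrN opprK mulrA [RHS]mulrC.
  apply/polyP => k; rewrite coefCM coef_take_poly coef1.
  by case: k => [|k]; rewrite ?mulr0 //= W0 wE.
pose V := w%:P * \sum_(j < i) ('X * s) ^+ j.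
have bez : s ^+ i * 'X^i + V * W = (pz ^+ 0)%:P.
  rewrite expr0 polyC1 /V mulrAC WE -exprMn [s * _]mulrC.
  have := subrX1 ('X * s) i => /(congr1 -%R); rewrite opprB -mulNr opprB => <-.
  by rewrite addrC subrK.
have dP : rdvd (pz ^+ (0 + 1))%:P (P - 'X^i * W).
  rewrite {1}PE addrK; apply/rdvd_polyC => j; rewrite coef_take_poly expr1.
  case: ltnP => [ji|_]; last exact: rdvd0.
  by apply: contrapT => /asboolP/minP; rewrite leqNgt ji.
have sP : size P = size ('X^i * W).
  by rewrite size_monicM ?monicXn ?monic_neq0 // size_polyXn szW addSn /= subnKC // ltnW.
have [g [h [ghE _ _ [a aE] [b bE]]]] :=
  hensel Zp_complete Zp_separated (monicXn _ i) mW bez mP sP dP.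
pose ev (u : {poly Defs.Zp Q}) : L := (map_poly phi u).[x].
have evM u v : ev (u * v) = ev u * ev v by rewrite /ev rmorphM hornerM.
have evD u v : ev (u + v) = ev u + ev v by rewrite /ev rmorphD hornerD.
have evX : ev 'X = x by rewrite /ev map_polyX hornerX.
have evp : ev (pz ^+ 1)%:P = p%:R by rewrite /ev map_polyC hornerC expr1 /= rmorph_nat.
have : ev g * ev h == 0 by rewrite -evM -ghE.
have gE : g = 'X^i + (pz ^+ 1)%:P * a by rewrite -aE addrC subrK.
have hE : h = W + (pz ^+ 1)%:P * b by rewrite -bE addrC subrK.
rewrite mulf_eq0 => /orP[/eqP g0|/eqP h0].
  right; exists i, (- a); move: g0; rewrite gE evD evM evp.
  rewrite {1}/ev map_polyXn hornerXn => /eqP; rewrite addr_eq0 => /eqP ->.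
  by rewrite /ev rmorphN hornerN mulrN.
left; exists s, (- (w%:P * b)); rewrite -/(ev s) -/(ev _).
have -> : ev (- (w%:P * b)) = - (ev w%:P * ev b) by rewrite -evM /ev rmorphN hornerN.
have : ev (w%:P * h) = 0 by rewrite evM h0 mulr0.
rewrite hE mulrDr WE !evD !evM evp.
have -> : ev (- ('X * s)) = - (x * ev s) by rewrite -{1}evX -evM /ev rmorphN hornerN.
have -> : ev 1 = 1 by rewrite /ev rmorph1 hornerC.
by move=> e; rewrite -[LHS]subr0 -e; ring.
Qed.

End Padic.

(** * Integrality *)

Lemma splitting_field_exists (K : fieldType) (f : {poly K}) : f \is monic ->
  exists (L : fieldType) (iota : {rmorphism K -> L}) (rs : seq L),
    map_poly iota f = \prod_(z <- rs) ('X - z%:P).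
Proof.
have [m] := ubnP (size f); elim: m K f => // m IH K f; rewrite ltnS => sf mf.
have [gs igs fE] := monic_factorization mf.
case: gs => [|g gs] in igs fE.
  exists K, idfun, [::]; rewrite fE !big_nil; exact: rmorph1.
have [L [_ [z rz _]]] := irredp_FAdjoin (igs g (mem_head _ _)).2.
pose iota : {rmorphism K -> L} := in_alg L.
have : root (map_poly iota f) z by rewrite fE big_cons rmorphM rootM rz.
move=> /factor_theorem[h hE].
have mh : h \is monic.
  by have := mf; rewrite -(map_monic iota) hE monicMr ?monicXsubC.
have sh : (size h < m)%N.
  have := size_map_poly iota f; rewrite hE size_Mmonic ?monicXsubC ?monic_neq0 //.
  by rewrite size_XsubC addn2 /= => ->.
have [L' [iota' [rs rsE]]] := IH L h sh mh.
exists L', (iota' \o iota), (iota' z :: rs).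
rewrite map_poly_comp hE rmorphM /= rsE big_cons mulrC; congr (_ * _).
by rewrite rmorphB /= map_polyX map_polyC.
Qed.

Section IntegralCoefficients.
Variables (A : comNzRingType) (K : fieldType) (phi : {rmorphism A -> K}).

Definition integral_coefs (g : {poly K}) := forall i, integralOver phi g`_i.

Lemma integral_coefsM g h : integral_coefs g -> integral_coefs h -> integral_coefs (g * h).
Proof.
move=> ig ih i; rewrite coefM; apply: (big_ind (integralOver phi)) => [||j _].
- exact: integral0.
- exact: integral_add.
exact: integral_mul.
Qed.

Lemma integral_coefs_map (L : fieldType) (iota : {rmorphism K -> L}) x :
  integralOver (iota \o phi) (iota x) -> integralOver phi x.
Proof.
move=> [P mP rP]; exists P => //; move: rP.
by rewrite map_poly_comp fmorph_root.
Qed.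

End IntegralCoefficients.

(** Over a splitting field the coefficients of a monic factor are polynomials
    in some of the roots of [f], which are integral. *)
Lemma integral_coefs_dvd (A : comNzRingType) (K : fieldType) (phi : {rmorphism A -> K})
    (f g : {poly K}) :
  f \is monic -> integral_coefs phi f -> g \is monic -> g %| f ->
  integral_coefs phi g.
Proof.
move=> mf inf mg gf; have [L [iota [rs rsE]]] := splitting_field_exists mf.
have inrs z : z \in rs -> integralOver (iota \o phi) z.
  move=> zrs; apply: (@integral_root_monic _ _ _ _ (map_poly iota f)).
  - by rewrite map_monic.
  - by rewrite rsE root_prod_XsubC.
  apply/integral_poly => i; rewrite coef_map; exact: integral_rmorph.
have : map_poly iota g %| \prod_(z <- rs) ('X - z%:P) by rewrite -rsE dvdp_map.
move=> /dvdp_prod_XsubC[m]; rewrite eqp_monic ?map_monic ?monic_prod_XsubC // => /eqP gE.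
move=> i; apply: (@integral_coefs_map _ _ _ _ iota); rewrite -coef_map gE big_seq; move: i.
apply: (big_ind (integral_coefs (iota \o phi))) => [i|h k ih ik|z zm i].
- by rewrite coef1; apply: integral_nat.
- exact: integral_coefsM.
rewrite coefB coefX coefC; apply: integral_sub; first exact: integral_nat.
by case: ifP => _; [apply/inrs/mem_mask/zm | apply: integral0].
Qed.

(** * The ring of integers of a finite extension *)

Section Integers.
Variables (R : realType) (p : nat) (Q : padic_numbers R p) (K : fieldExtType Q).
Hypothesis p_pr : prime p.
Local Notation abs := (@Qp_abs R p Q).
Local Notation O := (integers K).
Local Notation intK := (integralOver (@Zp_to_K R p Q K)).
Local Notation toK := (\val : O -> K).

Lemma integersP (x : K) : reflect (intK x) (x \in @in_integers _ _ Q K).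
Proof. exact: asboolP. Qed.

Lemma integers_lift (x : K) : intK x -> exists y : O, val y = x.
Proof. by move=> /integersP xO; exists (MkIntegers xO). Qed.

Lemma integers_val (x : O) : intK (val x).
Proof. by apply/integersP; apply: valP. Qed.

Lemma integers_lift_poly (g : {poly K}) :
  integral_coefs (@Zp_to_K R p Q K) g -> exists h : {poly O}, map_poly val h = g.
Proof.
move=> ig; have H i : exists y : O, val y = g`_i by apply: integers_lift.
have [h hP] := choice H; exists (\poly_(i < size g) h i).
apply/polyP => i; rewrite coef_map coef_poly.
by case: ltnP => [_|/(nth_default 0) ->]; [exact: hP | exact: rmorph0].
Qed.

Lemma integers_map_inj : injective (map_poly toK).
Proof.
move=> f g /polyP e; apply/polyP => i; apply: val_inj.
by have := e i; rewrite !coef_map.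
Qed.

Lemma integers_map_size (g : {poly O}) : size (map_poly toK g) = size g.
Proof. by rewrite size_map_inj_poly //; exact: val_inj. Qed.

Lemma integers_map_monic (g : {poly O}) : (map_poly toK g \is monic) = (g \is monic).
Proof.
rewrite !monicE !lead_coefE integers_map_size coef_map.
by apply/eqP/eqP => [e|->]; [apply: val_inj | exact: rmorph1].
Qed.

(** Gauss's lemma. *)
Lemma integers_monic_dvd (f : {poly O}) (g : {poly K}) :
  f \is monic -> g \is monic -> g %| map_poly val f ->
  exists2 h : {poly O}, h \is monic & map_poly val h = g.
Proof.
move=> mf mg gf.
have [h hE] : exists h : {poly O}, map_poly val h = g.
  apply/integers_lift_poly/(integral_coefs_dvd _ _ mg gf).
    by rewrite integers_map_monic.
  by move=> i; rewrite coef_map; apply: integers_val.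
by exists h; rewrite // -integers_map_monic hE.
Qed.

(** Division by a monic polynomial stays in the ring of integers. *)
Lemma integers_dvd (f g : {poly O}) : g \is monic ->
  map_poly val g %| map_poly val f -> exists h, f = h * g.
Proof.
move=> mg gf; exists (Pdiv.Ring.rdivp f g).
have fE := Pdiv.RingMonic.rdivp_eq mg f.
suff r0 : Pdiv.Ring.rmodp f g = 0 by rewrite {1}fE r0 addr0.
apply: integers_map_inj; rewrite rmorph0; apply/eqP; apply: contraTT gf => r0.
rewrite fE rmorphD rmorphM /= dvdp_addr; last exact: dvdp_mull.
apply/negP => /(dvdp_leq r0); rewrite !integers_map_size leqNgt.
by rewrite Pdiv.Ring.ltn_rmodpN0 ?monic_neq0.
Qed.

(** The structure map of the ring of integers over the p-adic integers. *)
Definition Zp_to_integers (z : Defs.Zp Q) : O :=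
  MkIntegers (introT (integersP _) (integral_id (@Zp_to_K R p Q K) z)).

Fact Zp_to_integers_zmod : zmod_morphism Zp_to_integers.
Proof. by move=> x y; apply: val_inj; rewrite /= rmorphB. Qed.

Fact Zp_to_integers_monoid : monoid_morphism Zp_to_integers.
Proof. by split=> [|x y]; apply: val_inj; rewrite /= ?rmorph1 ?rmorphM. Qed.

HB.instance Definition _ :=
  GRing.isZmodMorphism.Build (Defs.Zp Q) O Zp_to_integers Zp_to_integers_zmod.
HB.instance Definition _ :=
  GRing.isMonoidMorphism.Build (Defs.Zp Q) O Zp_to_integers Zp_to_integers_monoid.

Lemma integral_scale (c : Q) (x : K) : abs c <= 1 -> intK x -> intK (c *: x).
Proof.
move=> c1 ix; have cZ : c \in @in_Zp _ _ Q by [].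
rewrite -mulr_algl -[c%:A]/(Zp_to_K K (MkZp cZ)).
exact/integral_mul/ix/integral_id.
Qed.

Lemma Qp_abs_sum_lt (I : Type) (r : seq I) (F : I -> Q) (e : R) :
  0 < e -> (forall i, abs (F i) < e) -> abs (\sum_(i <- r) F i) < e.
Proof.
move=> e0 Fe; apply: (big_ind (fun x => abs x < e)) => //; first by rewrite Qp_abs0.
by move=> x y xe ye; apply: le_lt_trans (Qp_absD _ _) _; rewrite gt_max xe.
Qed.

Lemma Zp_integrally_closed (c : Q) : intK c%:A -> abs c <= 1.
Proof.
move=> [P mP rP'].
have [v vE] : exists v : {rmorphism Defs.Zp Q -> Q}, forall z, v z = val z by exists val.
have {rP'} rP : root (map_poly v P) c.
  have e : in_alg K \o v =1 Zp_to_K K by move=> z /=; rewrite vE.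
  by rewrite -(fmorph_root (in_alg K)) -map_poly_comp (eq_map_poly e).
rewrite leNgt; apply/negP => c1.
have c0 : c != 0 by apply: contraTneq c1 => ->; rewrite Qp_abs0 ltr10.
have ac : 0 < abs c by apply: Qp_abs_gt0.
have sP : (0 < size P)%N by rewrite size_poly_gt0 monic_neq0.
pose d := (size P).-1.
have szP : size (map_poly v P) = d.+1.
  by rewrite size_map_inj_poly ?rmorph0 ?prednK // => x y; rewrite !vE; exact: val_inj.
have : abs (c ^+ d) < abs c ^+ d; last by rewrite Qp_absX ltxx.
move: rP; rewrite /root horner_coef szP.
under eq_bigr => i _ do rewrite coef_map.
rewrite big_ord_recr /= addrC addr_eq0 -lead_coefE (monicP mP) rmorph1 mul1r => /eqP ->.
rewrite Qp_absN; apply: Qp_abs_sum_lt; first by rewrite exprn_gt0.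
move=> i; rewrite Qp_absM Qp_absX.
apply: le_lt_trans (_ : abs c ^+ i < _); last by rewrite ltr_eXn2l.
by rewrite vE ler_piMl ?Zp_abs_le1 // exprn_ge0 // ltW.
Qed.

Lemma p_nonunit : @max_ideal _ _ Q K p%:R.
Proof.
move=> [y py]; have := @Zp_integrally_closed p%:R^-1.
have -> : (p%:R^-1)%:A = val y :> K.
  have p0 : (p%:R : K) != 0 by rewrite -(rmorph_nat (in_alg K)) fmorph_eq0 p_neq0.
  apply: (mulfI p0); rewrite -in_algE fmorphV rmorph_nat divff //.
  by have := congr1 val py; rewrite rmorphM rmorph1 rmorph_nat => ->.
move=> /(_ (integers_val y)).
have := Qp_absM (p%:R : Q) p%:R^-1.
rewrite divff ?p_neq0 // Qp_abs1 Qp_abs_p // => /esym/(canRL (mulKf _)) ->; last first.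
  by rewrite invr_neq0 // pnatr_eq0 gtn_eqF ?prime_gt0.
by rewrite invrK mulr1 lern1 leqNgt prime_gt1.
Qed.

End Integers.

(** * Splitting types and reduction modulo the maximal ideal *)

Section Reduction.
Variables (R : realType) (p : nat) (Q : padic_numbers R p) (K : fieldExtType Q).
Hypothesis p_pr : prime p.
Variables (F : finFieldType) (red : {rmorphism integers K -> F}).
Hypothesis hred : is_residue_field red.
Local Notation O := (integers K).
Local Notation toK := (\val : O -> K).

Lemma red_p : red p%:R = 0.
Proof. by apply/hred.2/p_nonunit. Qed.

Lemma red_lift_poly (a : {poly F}) : exists b : {poly O}, map_poly red b = a.
Proof.
have [b bP] := choice hred.1; exists (\poly_(i < size a) b a`_i).
apply/polyP => i; rewrite coef_map coef_poly.
by case: ltnP => [_|/(nth_default 0) ->]; [exact: bP | exact: rmorph0].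
Qed.

Lemma size_red (g : {poly O}) : g \is monic -> size (map_poly red g) = size g.
Proof. by move=> mg; rewrite size_map_poly_id0 // (monicP mg) rmorph1 oner_neq0. Qed.

Lemma root_integers_dvd (L : fieldType) (iota : {rmorphism K -> L}) (al : L)
    (f g : {poly O}) : g \is monic -> irreducible_poly (map_poly val g) ->
  root (map_poly iota (map_poly toK g)) al -> root (map_poly iota (map_poly toK f)) al ->
  exists h, f = h * g.
Proof.
move=> mg ig rg rf; apply: integers_dvd => //.
case: (irreducible_coprimeVdvd (map_poly toK f) ig) => // co.
have : coprimep (map_poly iota (map_poly toK g)) (map_poly iota (map_poly toK f)).
  by rewrite coprimep_map.
by move=> /coprimep_root/(_ rg)/negP; rewrite -rootE.
Qed.

(** If the reduction split into coprime factors [a] and [b], the value at a root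
    [al] of [g] of a lift of [a] would be neither a unit nor nilpotent modulo
    [p] in [O[al]], which reduces to [F[X]/(a * b)]. *)
Lemma irreducible_reduction (g : {poly O}) : g \is monic ->
  irreducible_poly (map_poly val g) -> separable_poly (map_poly red g) ->
  irreducible_poly (map_poly red g).
Proof.
move=> mg ig sg; have mgb : map_poly red g \is monic by apply: monic_map.
have [hs ihs gE] := monic_factorization mgb.
case: hs => [|a hs] in ihs gE.
  case: ig => + _; rewrite integers_map_size -size_red // gE big_nil size_poly1.
  by rewrite ltnn.
have [ma ia] := ihs a (mem_head _ _).
case: hs => [|b0 hs] in ihs gE; first by rewrite gE big_seq1.
move: gE; rewrite big_cons; set b := \prod_(h <- _) h => gE.
have sb : (1 < size b)%N.
  have fact h (hin : h \in b0 :: hs) : h \is monic /\ irreducible_poly h.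
    by apply: ihs; rewrite inE hin orbT.
  have := size_monic_factors (fun h hin => (fact h hin).1) (fun h hin => (fact h hin).2.1).
  exact: leq_ltn_trans.
have coab : coprimep a b by apply: separable_coprime sg _; rewrite gE.
have [L [_ [al ral _]]] := irredp_FAdjoin ig.
pose iota : {rmorphism K -> L} := in_alg L.
have [A AE] := red_lift_poly a.
have [v vE] : exists v : {rmorphism O -> K}, forall z, v z = toK z by exists val.
pose phi : {rmorphism Defs.Zp Q -> L} := iota \o (@Zp_to_K R p Q K).
pose ev (u : {poly O}) : L := (map_poly iota (map_poly v u)).[al].
have evM u w : ev (u * w) = ev u * ev w by rewrite /ev !rmorphM hornerM.
have evD u w : ev (u + w) = ev u + ev w by rewrite /ev !rmorphD hornerD.
have evN u : ev (- u) = - ev u by rewrite /ev !rmorphN hornerN.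
have evp : ev p%:R = p%:R.
  rewrite /ev !rmorph_nat -polyC_natr. by rewrite hornerC.
have evX u k : ev (u ^+ k) = ev u ^+ k by rewrite /ev !rmorphXn horner_exp.
have ev0 u : ev u = 0 -> exists h, u = h * g.
  move=> u0; apply: (@root_integers_dvd L iota al) => //.
  by rewrite -(eq_map_poly vE) /root -/(ev u) u0.
have iev u : integralOver phi (ev u).
  apply: integral_horner; last first.
    apply: (@integral_root_monic _ _ _ _ (map_poly iota (map_poly toK g))) => //.
      by rewrite map_monic integers_map_monic.
    apply/integral_poly => i; rewrite coef_map coef_map.
    by apply: integral_rmorph; apply: integers_val.
  apply/integral_poly => i; rewrite coef_map coef_map.
  by apply: integral_rmorph; have := integers_val u`_i; rewrite -vE.
have comp (u : {poly Defs.Zp Q}) :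
    (map_poly phi u).[ev A] = ev (map_poly (@Zp_to_integers R p Q K) u \Po A).
  rewrite /ev !map_comp_poly horner_comp; congr (_ .[_]).
  by rewrite -!map_poly_comp; apply: eq_map_poly => z; rewrite /= vE.
pose rZ u := map_poly red (map_poly (@Zp_to_integers R p Q K) u \Po A).
have redp : map_poly red p%:R = 0.
  by rewrite rmorph_nat -polyC_natr -(rmorph_nat red) red_p.
case: (integral_unit_or_nilpotent p_pr (iev A)) => [[u [t e]]|[i [t e]]].
- have [h hE] : exists h, 1 - (A * (map_poly (@Zp_to_integers R p Q K) u \Po A)
      + p%:R * (map_poly (@Zp_to_integers R p Q K) t \Po A)) = h * g.
    apply: ev0; rewrite evD evN evD !evM evp -!comp -e.
    by rewrite /ev !rmorph1 hornerC subrr.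
  have := congr1 (map_poly red) hE.
  rewrite rmorphB rmorph1 rmorphD !rmorphM /= redp mul0r addr0 AE gE.
  move=> /eqP; rewrite subr_eq => /eqP e1.
  have : a %| 1 by rewrite e1; apply: dvdp_add; rewrite ?[_ * (a * b)]mulrCA dvdp_mulr.
  by rewrite dvdp1 => /eqP sa; case: ia; rewrite sa.
have [h hE] : exists h, A ^+ i - p%:R * (map_poly (@Zp_to_integers R p Q K) t \Po A) = h * g.
  by apply: ev0; rewrite evD evN evM evp evX -comp -e subrr.
have := congr1 (map_poly red) hE.
rewrite rmorphB rmorphXn !rmorphM /= redp mul0r subr0 AE gE => e1.
have : b %| a ^+ i by rewrite e1 mulrA dvdp_mull.
have cob : coprimep b (a ^+ i) by rewrite coprimep_expr // coprimep_sym.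
move=> /coprimep_dvdl/(_ cob); rewrite coprimepp => /eqP sb1.
by rewrite sb1 in sb.
Qed.

Lemma splitting_type_reduction_imp (f : {poly O}) mu : f \is monic ->
  separable_poly (map_poly red f) -> has_splitting_type (map_poly toK f) mu ->
  has_splitting_type (map_poly red f) mu.
Proof.
move=> mf sf [gs [igs fE <-]].
have H g : exists h : {poly O}, g \in gs -> h \is monic /\ map_poly toK h = g.
  case: (boolP (g \in gs)) => [gin|_]; last by exists 0.
  have gf : g %| map_poly toK f by rewrite fE (big_rem g) //= dvdp_mulr.
  by have [h mh hE] := integers_monic_dvd mf (igs g gin).1 gf; exists h.
have [h hP] := choice H.
have fO : f = \prod_(g <- gs) h g.
  apply: integers_map_inj; rewrite fE rmorph_prod /= big_seq [RHS]big_seq.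
  by apply: eq_bigr => g /hP[].
exists [seq map_poly red (h g) | g <- gs]; split.
- move=> _ /mapP[g gin ->]; have [mh hE] := hP g gin.
  split; first exact: monic_map.
  apply: irreducible_reduction => //; first by rewrite hE; case: (igs g gin).
  apply: dvdp_separable sf; rewrite fO rmorph_prod /= (big_rem g) //=; exact: dvdp_mulr.
- by rewrite big_map fO rmorph_prod.
congr sort; rewrite -map_comp; apply/eq_in_map => g gin /=.
have [mh hE] := hP g gin.
by rewrite size_red // -integers_map_size hE.
Qed.

Lemma splitting_type_reduction (f : {poly O}) mu : f \is monic ->
  separable_poly (map_poly red f) ->
  has_splitting_type (map_poly toK f) mu <-> has_splitting_type (map_poly red f) mu.
Proof.
move=> mf sf; split; first exact: splitting_type_reduction_imp.
have [|nu hnu] := @has_splitting_type_ex _ (map_poly toK f).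
  by rewrite integers_map_monic.
have := splitting_type_reduction_imp mf sf hnu.
by move=> /splitting_type_unique u /u <-.
Qed.

Lemma integers_natr_neq0 m : (0 < m)%N -> (m%:R : O) != 0.
Proof.
move=> m0; apply/eqP => e.
have : (m%:R : K) = 0 by rewrite -(rmorph_nat toK) e rmorph0.
rewrite -(rmorph_nat (in_alg K)) => /eqP; rewrite fmorph_eq0 => /eqP {}e.
have := Qp_abs_rat Q m%:Z%:~R; rewrite /ratr numq_int denq_int divr1 -pmulrn e Qp_abs0.
rewrite /rat_padic_abs intr_eq0 eqz_nat gtn_eqF // numq_int denq_int logn1 expr0 div1r.
by move=> /esym/eqP; apply/negP; rewrite invr_eq0 expf_neq0 // pnatr_eq0 -lt0n prime_gt0.
Qed.

(** The characteristic is 0, even if that of the residue field divides the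
    degree. *)
Lemma size_deriv_integers (f : {poly O}) n : f \is monic -> size f = n.+2 ->
  size f^`() = n.+1.
Proof.
move=> mf sf; apply/eqP; rewrite eqn_leq; apply/andP; split.
  by rewrite -ltnS -sf lt_size_deriv // monic_neq0.
apply: contraT; rewrite -leqNgt => /leq_sizeP/(_ n (leqnn n)).
rewrite coef_deriv -[n.+1]/(n.+2.-1) -sf -lead_coefE (monicP mf) => /eqP.
by rewrite (negPf (integers_natr_neq0 _)) // sf.
Qed.

(** The Sylvester matrix of [f] and [f'] reduces to the matrix of the map
    [(u, w) |-> u * f + w * f'], injective on the relevant degrees when the
    reduction of [f] is separable. *)
Lemma resultant_reduction (f : {poly O}) n : f \is monic -> size f = n.+3 ->
  (red (resultant f f^`()) != 0) = separable_poly (map_poly red f).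
Proof.
move=> mf sf; have sf' := size_deriv_integers mf sf; set fb := map_poly red f.
have sfb : size fb = n.+3 by rewrite size_red.
have derE : fb^`() = map_poly red f^`() by rewrite deriv_map.
apply/idP/idP => [rN0|].
  have [||[u w] /= _ uw] := @resultant_in_ideal _ f f^`(); rewrite ?sf ?sf' //.
  rewrite unlock; apply/Bezout_coprimepP.
  exists (map_poly red u, map_poly red w) => /=.
  have <- : map_poly red (resultant f f^`())%:P = map_poly red u * fb + map_poly red w * fb^`().
    by rewrite uw rmorphD !rmorphM derE.
  by rewrite map_polyC polyC_eqp1.
rewrite unlock => co; rewrite /resultant -det_map_mx; apply/det0P => -[v v0 vM].
have rVE d (a : 'rV[F]_d) : rVpoly a = \sum_(k < d) a 0 k *: 'X^k.
  by rewrite /rVpoly poly_def; apply: eq_bigr => k _; rewrite valK.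
pose u := rVpoly (lsubmx v); pose w := rVpoly (rsubmx v).
have su : (size u <= n.+1)%N by apply: leq_trans (size_poly _ _) _; rewrite sf'.
have sw : (size w <= n.+2)%N by apply: leq_trans (size_poly _ _) _; rewrite sf.
have coefE d (a : 'rV[F]_d) (h : {poly O}) j : (rVpoly a * map_poly red h)`_j =
    \sum_(k < d) a 0 k * red (h`_(j - k) *+ (k <= j)).
  rewrite rVE mulr_suml coef_sum; apply: eq_bigr => k _.
  rewrite -scalerAl coefZ coefXnM coef_map; case: (leqP k j) => _.
    by rewrite mulr1n.
  by rewrite mulr0n rmorph0.
have uw0 : u * fb + w * fb^`() = 0.
  apply/polyP => j; rewrite coef0.
  have [jS|jL] := ltnP j ((size f^`()).-1 + (size f).-1)%N; last first.
    apply/leq_sizeP: j jL; rewrite sf sf' (leq_trans (size_polyD _ _)) // geq_max.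
    have sfb' : (size fb^`() <= n.+2)%N by rewrite -ltnS -sfb lt_size_deriv // -size_poly_gt0 sfb.
    apply/andP; split; apply: leq_trans (size_polyMleq _ _) _.
      by rewrite sfb; move: su; move: (size u); lia.
    by move: sw sfb'; move: (size w) (size fb^`()); lia.
  have := congr1 (fun a : 'rV__ => a 0 (Ordinal jS)) vM.
  rewrite [LHS]mxE [RHS]mxE big_split_ord /= => vj; rewrite coefD derE !coefE -[RHS]vj.
  congr (_ + _); apply: eq_bigr => k _; rewrite [map_mx _ _ _ _]mxE Sylvester_mxE.
    by rewrite [lsubmx v _ _]mxE -[lshift _ k]/(unsplit (inl k)) unsplitK.
  by rewrite [rsubmx v _ _]mxE -[rshift _ k]/(unsplit (inr k)) unsplitK.
have w0 : w = 0.
  have : fb %| w.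
    rewrite -(Gauss_dvdpl _ co); apply/dvdpP; exists (- u).
    by rewrite mulNr; apply/eqP; rewrite -addr_eq0 addrC uw0.
  by apply: contraTeq => wN0; rewrite gtNdvdp // sfb ltnS (leq_trans sw).
have u0 : u = 0.
  move/eqP: uw0; rewrite w0 mul0r addr0 mulf_eq0 -(size_poly_eq0 fb) sfb orbF => /eqP //.
case/eqP: v0; rewrite -(hsubmxK v) -(rVpolyK (lsubmx v)) -(rVpolyK (rsubmx v)).
by rewrite -/u -/w u0 w0 !linear0 row_mx0.
Qed.

Lemma disc_reduction (f : {poly O}) n : f \is monic -> size f = n.+3 ->
  max_ideal (disc f) <-> ~~ separable_poly (map_poly red f).
Proof.
move=> mf sf; rewrite -hred.2 /disc rmorphM rmorph_sign -(resultant_reduction mf sf) negbK.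
split=> [/eqP|/eqP ->]; last by rewrite mulr0.
by rewrite mulf_eq0 signr_eq0.
Qed.

Lemma square_free_of_reduction (f : {poly O}) n : f \is monic -> size f = n.+3 ->
  separable_poly (map_poly red f) -> square_free (map_poly toK f).
Proof.
move=> mf sf sep; apply: coprime_deriv_square_free.
have sf' := size_deriv_integers mf sf.
have [||[u w] /= _ uw] := @resultant_in_ideal _ f f^`(); rewrite ?sf ?sf' //.
have rN0 : toK (resultant f f^`()) != 0.
  apply/eqP => r0; have := resultant_reduction mf sf; rewrite sep.
  have -> : resultant f f^`() = 0 by apply: val_inj; rewrite r0 rmorph0.
  by rewrite rmorph0 eqxx.
apply/Bezout_coprimepP; exists (map_poly toK u, map_poly toK w) => /=.
have <- : map_poly toK (resultant f f^`())%:P =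
    map_poly toK u * map_poly toK f + map_poly toK w * (map_poly toK f)^`().
  by rewrite uw rmorphD !rmorphM deriv_map.
by rewrite map_polyC polyC_eqp1.
Qed.

Variables (n : nat) (mu : seq nat).
Hypothesis n2 : (2 <= n)%N.

Lemma Pstar_setE (a : n.-tuple O) :
  Pstar_set mu a <-> [tuple of map red a] \in separable_of_type F n mu.
Proof.
pose f : {poly O} := monic_tuple a.
have mf : f \is monic := monic_monic_tuple a.
have sf : size f = n.-2.+3 by rewrite size_monic_tuple; case: (n) n2 => [|[]].
have fE : map_poly red f = monic_tuple [tuple of map red a] by apply: map_monic_tuple.
rewrite inE -fE; split.
  move=> [[_ ht] nd]; have sep : separable_poly (map_poly red f).
    by apply: contraT => /(disc_reduction mf sf).
  by rewrite sep; apply/asboolP/(splitting_type_reduction _ mf sep).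
move=> /andP[sep /asboolP ht]; split; last by move/(disc_reduction mf sf)/negP.
split; first exact: square_free_of_reduction mf sf sep.
exact/(splitting_type_reduction _ mf sep).
Qed.

Lemma P_set_cases (a : n.-tuple O) : P_set mu a ->
  Pstar_set mu a \/ [tuple of map red a] \in inseparable F n.
Proof.
move=> [sqf ht]; rewrite Pstar_setE !inE -!map_monic_tuple.
case: (boolP (separable_poly _)) => sep; last by right.
left; apply/asboolP/(splitting_type_reduction _ _ sep) => //.
exact: monic_monic_tuple.
Qed.

End Reduction.

(** * Completeness of the ring of integers *)

Section Completeness.
Variables (R : realType) (p : nat) (Q : padic_numbers R p) (K : fieldExtType Q).
Hypothesis p_pr : prime p.
Local Notation abs := (@Qp_abs R p Q).
Local Notation O := (integers K).
Local Notation toK := (\val : O -> K).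
Local Notation intK := (integralOver (@Zp_to_K R p Q K)).
Local Notation pz := (p%:R : Defs.Zp Q).
Local Notation pq := (p%:R : Q).

Let p_gt0 : (0 : R) < p%:R. Proof. by rewrite ltr0n prime_gt0. Qed.

Lemma Qp_abs_pV M : abs (pq ^- M) = p%:R ^+ M.
Proof.
apply: (mulfI (_ : abs (pq ^+ M) != 0)).
  by rewrite Qp_abs_pX // invr_neq0 // expf_neq0 // gt_eqF.
rewrite -Qp_absM divff ?expf_neq0 ?p_neq0 // Qp_abs1 Qp_abs_pX // mulVf //.
by rewrite expf_neq0 // gt_eqF.
Qed.

Lemma integral_p_scale M (c : Q) x : abs c <= p%:R ^- M -> intK x ->
  intK (pq ^- M *: (c *: x)).
Proof.
move=> cM ix; rewrite scalerA; apply: integral_scale ix.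
by rewrite Qp_absM Qp_abs_pV mulrC -ler_pdivlMr ?exprn_gt0 // mul1r.
Qed.

Lemma integral_p_weaken M N x : (M <= N)%N -> intK (pq ^- N *: x) -> intK (pq ^- M *: x).
Proof.
move=> MN ix; have -> : pq ^- M *: x = pq ^+ (N - M) *: (pq ^- N *: x).
  have e : pq ^+ N = pq ^+ (N - M) * pq ^+ M by rewrite -exprD subnK.
  by rewrite scalerA e invfM mulrA divff ?mul1r // expf_neq0 // p_neq0.
apply: integral_scale ix; rewrite Qp_abs_pX // invf_le1 ?exprn_gt0 //.
by rewrite exprn_ege1 // ler1n prime_gt0.
Qed.

Lemma val_p_exp M (t : O) : val ((p%:R : O) ^+ M * t) = pq ^+ M *: val t.
Proof.
rewrite rmorphM rmorphXn rmorph_nat -mulr_algl -in_algE rmorphXn rmorph_nat.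
by [].
Qed.

Lemma rdvd_integers M (x : O) : rdvd ((p%:R : O) ^+ M) x <-> intK (pq ^- M *: val x).
Proof.
have pM : pq ^+ M != 0 by rewrite expf_neq0 // p_neq0.
split=> [[t ->]|ix].
  by rewrite val_p_exp scalerA mulVf // scale1r; apply: integers_val.
have [t tE] := integers_lift ix; exists t; apply: val_inj.
by rewrite val_p_exp tE scalerA mulfV // scale1r.
Qed.

Lemma rdvd_Zp_to_integers M (z : Defs.Zp Q) :
  rdvd ((p%:R : O) ^+ M) (Zp_to_integers K z) -> rdvd (pz ^+ M) z.
Proof.
move=> /rdvd_integers; rewrite /= -[Zp_to_K K z]/((val z)%:A) scalerA.
move=> /Zp_integrally_closed.
rewrite Qp_absM Qp_abs_pV mulrC -ler_pdivlMr ?exprn_gt0 // mul1r => h.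
exact/rdvd_Zp.
Qed.

(** The constant term of an equation of [x] over the p-adic integers is a
    multiple of [x], so it is 0 if [x] is divisible by all powers of [p]; then
    [x] can be cancelled, and the equation shrinks to 0. *)
Lemma integers_separated : adic_separated (p%:R : O).
Proof.
move=> x H; apply/eqP/negPn/negP => x0.
have xr (y : O) : x * y = 0 -> y = 0.
  move=> /(congr1 val); rewrite rmorphM rmorph0 => /eqP; rewrite mulf_eq0 => /orP[]/eqP e.
    by case/eqP: x0; apply: val_inj; rewrite e rmorph0.
  by apply: val_inj; rewrite e rmorph0.
have key (G : {poly Defs.Zp Q}) : (map_poly (@Zp_to_integers R p Q K) G).[x] = 0 -> G = 0.
  elim/poly_ind: G => [//|G c IH].
  rewrite rmorphD rmorphM /= map_polyX map_polyC /= !hornerE => e.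
  have c0 : c = 0.
    apply: (Zp_separated p_pr) => j; apply: rdvd_Zp_to_integers.
    have -> : Zp_to_integers K c = x * - (map_poly (@Zp_to_integers R p Q K) G).[x].
      by apply/eqP; rewrite mulrN -addr_eq0 [x * _]mulrC addrC e.
    exact: rdvd_mulr.
  rewrite c0 addr0 IH ?mul0r //; apply: xr.
  by move: e; rewrite c0 rmorph0 addr0 mulrC.
have [P mP rP] := integers_val x.
have : P = 0.
  apply: key; apply: val_inj; rewrite rmorph0 -(eqP rP) -horner_map -map_poly_comp.
  by congr (_ .[_]); apply: eq_map_poly.
by apply/eqP; rewrite monic_neq0.
Qed.

Lemma integral_separated (x : K) : (forall j, intK (pq ^- j *: x)) -> x = 0.
Proof.
move=> H; have := H 0%N; rewrite expr0 invr1 scale1r => /integers_lift[y yE].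
rewrite -yE (_ : y = 0) ?rmorph0 //; apply: integers_separated => j.
by apply/rdvd_integers; rewrite yE.
Qed.

Lemma abs_le_pX (c : Q) : exists k, abs c <= p%:R ^+ k.
Proof.
have [-> |c0] := eqVneq c 0; first by exists 0%N; rewrite Qp_abs0 expr0 ler01.
have ac : 0 < (abs c)^-1 by rewrite invr_gt0 Qp_abs_gt0.
have [k] := exp_inv_lt (prime_gt1 p_pr) ac.
by exists k; rewrite -lef_pV2 ?posrE ?exprn_gt0 ?Qp_abs_gt0 // ltW.
Qed.

(** Multiplying a root by [p ^+ N] multiplies the coefficient of index [i] of its
    monic equation of degree [d] by [p ^+ (N * (d - i))], which for [i < d]
    clears the denominator of that coefficient if [N] is large. *)
Lemma integral_multiple (x : K) : exists k, intK (pq ^+ k *: x).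
Proof.
have [f mf rf] : exists2 f : {poly Q}, f \is monic & root (map_poly (in_alg K) f) x.
  have /polyOver1P[f fE] := minPolyOver 1 x; exists f.
    by have := monic_minPoly 1 x; rewrite fE map_monic.
  by have := root_minPoly 1 x; rewrite fE.
pose d := (size f).-1.
have sf : size f = d.+1 by rewrite prednK // size_poly_gt0 monic_neq0.
have [k kP] := choice (fun i => abs_le_pX f`_i).
pose N := \max_(i < d) k i; exists N.
pose g : {poly K} := map_poly (in_alg K) (\poly_(i < d.+1) (pq ^+ (N * (d - i)) * f`_i)).
have szg : size (\poly_(i < d.+1) (pq ^+ (N * (d - i)) * f`_i)) = d.+1.
  apply: size_poly_eq; rewrite subnn muln0 expr0 mul1r.
  have := monicP mf; rewrite lead_coefE sf /= => ->; exact: oner_neq0.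
apply: (@integral_root_monic _ _ _ _ g).
- rewrite map_monic monicE lead_coefE szg coef_poly ltnSn subnn muln0 expr0 mul1r.
  by have := monicP mf; rewrite lead_coefE sf /= => ->.
- rewrite /root horner_coef size_map_poly szg.
  have : pq ^+ (N * d) *: (map_poly (in_alg K) f).[x] = 0 by rewrite (rootP rf) scaler0.
  rewrite horner_coef size_map_poly sf scaler_sumr => e; apply/eqP; rewrite -[RHS]e.
  apply: eq_bigr => i _; rewrite !coef_map coef_poly ltn_ord /=.
  rewrite !mulr_algl exprZn !scalerA; congr (_ *: _).
  by rewrite mulrAC -exprM -exprD -mulnDr subnK // -ltnS ltn_ord.
apply/integral_poly => i; rewrite coef_map coef_poly.
case: ltnP => [iS|_]; last by rewrite /= scale0r; apply: integral0.
apply: integral_scale; last exact: integral1.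
have [id|] := ltnP i d; last first.
  rewrite leq_eqVlt ltnNge -ltnS iS orbF => /eqP <-.
  rewrite subnn muln0 expr0 mul1r; have := monicP mf; rewrite lead_coefE sf /= => ->.
  by rewrite Qp_abs1.
rewrite Qp_absM Qp_abs_pX // mulrC ler_pdivrMr ?exprn_gt0 // mul1r.
apply: le_trans (kP i) _; rewrite ler_weXn2l ?ler1n ?prime_gt0 //.
apply: leq_trans (_ : N <= _)%N; last by rewrite leq_pmulr // subn_gt0.
exact: (leq_bigmax (Ordinal id)).
Qed.

Section Lattice.
Variables (d : nat) (b : 'I_d -> K).
Hypothesis ib : forall i, intK (b i).

Definition comb (c : 'rV[Q]_d) : K := \sum_i c 0 i *: b i.

Hypothesis free_b : forall c, comb c = 0 -> c = 0.
Hypothesis span_b : forall x, exists c, x = comb c.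

Lemma combD c c' : comb (c + c') = comb c + comb c'.
Proof. by rewrite -big_split; apply: eq_bigr => i _; rewrite mxE scalerDl. Qed.

Lemma combZ a c : comb (a *: c) = a *: comb c.
Proof. by rewrite scaler_sumr; apply: eq_bigr => i _; rewrite mxE scalerA. Qed.

Lemma combB c c' : comb (c - c') = comb c - comb c'.
Proof. by rewrite -[- c']scaleN1r combD combZ scaleN1r. Qed.

Lemma integral_sum_seq (I : Type) (r : seq I) (P : pred I) (G : I -> K) :
  (forall i, intK (G i)) -> intK (\sum_(i <- r | P i) G i).
Proof.
move=> iG; apply: (big_ind (fun x => intK x)) => //; first exact: integral0.
exact: integral_add.
Qed.

Lemma integral_comb M (c : 'rV[Q]_d) :
  (forall i, abs (c 0 i) <= p%:R ^- M) -> intK (pq ^- M *: comb c).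
Proof.
move=> cM; rewrite scaler_sumr; apply: integral_sum_seq => i.
exact: integral_p_scale.
Qed.

(** Induction on the number [r] of basis vectors. If the last coordinate were
    unbounded, normalizing it to 1 would give vectors of the span of the first
    [r + 1] basis vectors tending to 0 whose other coordinates, bounded by
    induction, converge: a nontrivial linear relation in the limit. *)
Lemma coordinates_bounded r : (r <= d)%N -> exists N, forall c : 'rV[Q]_d,
  (forall i : 'I_d, (r <= i)%N -> c 0 i = 0) -> intK (comb c) ->
  forall i, abs (c 0 i) <= p%:R ^+ N.
Proof.
elim: r => [|r IH] rd.
  by exists 0%N => c c0 _ i; rewrite c0 // Qp_abs0 expr0 ler01.
have [N NP] := IH (ltnW rd); pose i0 := Ordinal rd.
have nlt (i : 'I_d) : (r <= i)%N -> i != i0 -> (r < i)%N.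
  by rewrite leq_eqVlt => /predU1P[e /eqP[]|//]; apply: val_inj.
have pN0 k : pq ^+ k != 0 by rewrite expf_neq0 // p_neq0.
case: (pselect (exists M, forall c : 'rV[Q]_d,
    (forall i : 'I_d, (r < i)%N -> c 0 i = 0) -> intK (comb c) ->
    abs (c 0 i0) <= p%:R ^+ M)) => [[M MP]|nM].
  (* Bounded last coordinate: subtract it and apply the induction hypothesis. *)
  exists (N + M)%N => c c0 ic i; have cM := MP c c0 ic.
  pose c' := pq ^+ M *: (c - c 0 i0 *: delta_mx 0 i0).
  have c'E j : c' 0 j = if j == i0 then 0 else pq ^+ M * c 0 j.
    rewrite !mxE eqxx /=; case: eqP => [->|_]; first by rewrite mulr1 subrr mulr0.
    by rewrite mulr0 subr0.
  have comb_delta : comb (delta_mx 0 i0) = b i0.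
    rewrite /comb (bigD1 i0) //= big1 => [|j /negPf ji]; rewrite mxE ?eqxx ?ji ?scale0r //.
    by rewrite scale1r addr0.
  have ic' : intK (comb c').
    rewrite combZ combB combZ comb_delta scalerBr; apply: integral_sub.
      apply: integral_scale ic; rewrite Qp_abs_pX // invf_le1 ?exprn_gt0 //.
      by rewrite exprn_ege1 // ler1n prime_gt0.
    rewrite scalerA; apply: integral_scale => //.
    by rewrite Qp_absM Qp_abs_pX // mulrC ler_pdivrMr ?exprn_gt0 // mul1r.
  have c'0 (j : 'I_d) : (r <= j)%N -> c' 0 j = 0.
    by move=> rj; rewrite c'E; case: eqP => // /eqP/(nlt _ rj)/c0 ->; rewrite mulr0.
  have [->|ii] := eqVneq i i0.
    by apply: le_trans cM _; rewrite ler_weXn2l ?ler1n ?prime_gt0 // leq_addl.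
  have := NP c' c'0 ic' i; rewrite c'E (negPf ii) Qp_absM Qp_abs_pX //.
  by rewrite mulrC ler_pdivrMr ?exprn_gt0 // -exprD.
(* Unbounded last coordinate: [w M] is a vector whose last coordinate exceeds
   [p ^+ M], divided by that coordinate. *)
have H M : exists w : 'rV[Q]_d, [/\ forall i : 'I_d, (r < i)%N -> w 0 i = 0,
    w 0 i0 = 1 & intK (pq ^- M *: comb w)].
  have [c [c0 ic cM]] : exists c : 'rV[Q]_d, [/\ forall i : 'I_d, (r < i)%N -> c 0 i = 0,
      intK (comb c) & p%:R ^+ M < abs (c 0 i0)].
    apply: contrapT => nc; apply: nM; exists M => c c0 ic.
    by rewrite leNgt; apply/negP => lt; apply: nc; exists c.
  have cN0 : c 0 i0 != 0.
    by apply: contraTneq cM => ->; rewrite Qp_abs0 -leNgt exprn_ge0 // ltW.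
  exists ((c 0 i0)^-1 *: c); split.
  - by move=> i ri; rewrite mxE (c0 i ri) mulr0.
  - by rewrite mxE mulVf.
  rewrite combZ; apply: integral_p_scale ic.
  have ac : 0 < abs (c 0 i0) by apply: Qp_abs_gt0.
  have -> : abs (c 0 i0)^-1 = (abs (c 0 i0))^-1.
    by apply: (mulfI (lt0r_neq0 ac)); rewrite -Qp_absM !divff ?Qp_abs1 // lt0r_neq0.
  by rewrite lef_pV2 ?posrE ?exprn_gt0 // ltW.
have [w wP] := choice H.
pose D M := w M.+1 - w M.
have Dbound M i : abs (D M 0 i) <= p%:R ^+ N * p%:R ^- M.
  have [s1 o1 i1] := wP M.+1; have [s2 o2 i2] := wP M.
  have := NP (pq ^- M *: D M) _ _ i; rewrite mxE Qp_absM Qp_abs_pV mulrC.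
  rewrite -ler_pdivlMr ?exprn_gt0 //; apply.
    move=> j rj; rewrite !mxE; have [->|ji] := eqVneq j i0; first by rewrite o1 o2 subrr mulr0.
    by rewrite s1 ?s2 ?subrr ?mulr0 //; apply: nlt.
  rewrite combZ combB scalerBr; apply: integral_sub i2.
  exact: integral_p_weaken i1.
have pN0' : (0 : R) < p%:R ^+ N by rewrite exprn_gt0.
have /choice[l lP] i : exists l, forall j, abs (l - w j 0 i) <= p%:R ^+ N * p%:R ^- j.
  apply: (@Qp_complete_geometric _ _ _ p_pr _ (fun j => w j 0 i)) => // j.
  by have := Dbound j i; rewrite !mxE.
pose lv : 'rV[Q]_d := \row_i l i.
have lv0 : lv = 0.
  apply/free_b/integral_separated => j; have [_ _ iw] := wP (N + j)%N.
  rewrite -(subrK (w (N + j)%N) lv) combD scalerDr; apply: integral_add.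
    apply: integral_comb => i; rewrite !mxE; apply: le_trans (lP _ _) _.
    by rewrite exprD invfM mulrA divff ?mul1r // gt_eqF.
  by apply: integral_p_weaken iw; apply: leq_addl.
have := lP i0 N.+1; have [_ -> _] := wP N.+1.
have -> : l i0 = 0 by have := congr1 (fun v : 'rV__ => v 0 i0) lv0; rewrite !mxE.
rewrite sub0r Qp_absN Qp_abs1 exprSr invfM mulrA divff ?gt_eqF // mul1r.
by rewrite leNgt invf_lt1 // ltr1n prime_gt1.
Qed.

Lemma complete_of_basis : adic_complete (p%:R : O).
Proof.
have [N NP] := coordinates_bounded (leqnn d).
have pN0' : (0 : R) < p%:R ^+ N by rewrite exprn_gt0.
move=> u du; have [c cE] := choice (fun j => span_b (val (u j))).
have /choice[l lP] i : exists l, forall j, abs (l - c j 0 i) <= p%:R ^+ N * p%:R ^- j.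
  apply: (@Qp_complete_geometric _ _ _ p_pr _ (fun j => c j 0 i)) => // j.
  have := NP (pq ^- j *: (c j.+1 - c j)) _ _ i.
  rewrite !mxE Qp_absM Qp_abs_pV mulrC -ler_pdivlMr ?exprn_gt0 //; apply.
    by move=> k; rewrite leqNgt ltn_ord.
  by rewrite combZ combB -!cE -rmorphB; apply/rdvd_integers.
have dist j : intK (pq ^- j *: (comb (\row_i l i) - val (u j))).
  have -> : comb (\row_i l i) - val (u j) =
      comb (\row_i l i - c (N + j)%N) + val (u (N + j)%N - u j).
    by rewrite combB -cE rmorphB addrA subrK.
  rewrite scalerDr; apply: integral_add.
    apply: integral_comb => i; rewrite !mxE; apply: le_trans (lP _ _) _.
    by rewrite exprD invfM mulrA divff ?mul1r // gt_eqF.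
  apply/rdvd_integers; elim: N {NP pN0' lP} => [|k IH]; first by rewrite subrr; apply: rdvd0.
  rewrite addSn -(subrK (u (k + j)%N) (u _)) -addrA; apply: rdvdD => //.
  by apply: rdvd_trans (du _); apply: rdvd_exp; rewrite leq_addl.
have [x xE] : exists x : O, val x = comb (\row_i l i).
  apply: integers_lift; rewrite -(subrK (val (u 0%N)) (comb _)); apply: integral_add.
    by have := dist 0%N; rewrite expr0 invr1 scale1r.
  exact: integers_val.
by exists x => j; apply/rdvd_integers; have := dist j; rewrite -xE -rmorphB.
Qed.

End Lattice.

Lemma integers_complete : adic_complete (p%:R : O).
Proof.
pose e := vbasis {:K}; pose d := \dim {:K}.
have [k kP] := choice (fun i : 'I_d => integral_multiple e`_i).
have pN0 m : pq ^+ m != 0 by rewrite expf_neq0 // p_neq0.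
apply: (@complete_of_basis d (fun i => pq ^+ k i *: e`_i)) => // [c|x].
  move=> c0; apply/rowP => i; rewrite mxE.
  have /freeP/(_ (fun i => c 0 i * pq ^+ k i)) fr := basis_free (vbasisP {:K}).
  have /fr/(_ i)/eqP : \sum_(i < d) (c 0 i * pq ^+ k i) *: e`_i = 0.
    by rewrite -[RHS]c0; apply: eq_bigr => j _; rewrite scalerA.
  by rewrite mulf_eq0 (negPf (pN0 _)) orbF => /eqP.
exists (\row_i (coord e i x * pq ^- k i)); rewrite {1}(coord_vbasis (memvf x)).
apply: eq_bigr => i _; rewrite mxE scalerA -mulrA mulVf // mulr1.
by [].
Qed.

End Completeness.

From mathcomp Require Import classical_sets.

(** * Factorization degrees are locally constant *)

Lemma factor_count_le (L : fieldType) (gs hs : seq {poly L}) :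
  monic_irreducibles gs -> (forall h, h \in hs -> h \is monic /\ (1 < size h)%N) ->
  \prod_(g <- gs) g = \prod_(h <- hs) h -> (size hs <= size gs)%N.
Proof.
move=> igs hhs e.
have [ks [iks ksE le]] : exists ks : seq {poly L}, [/\ monic_irreducibles ks,
    \prod_(k <- ks) k = \prod_(h <- hs) h & (size hs <= size ks)%N].
  elim: hs {e} hhs => [|h hs IH] hhs; first by exists [::]; split; rewrite ?big_nil.
  have [|ks [iks ksE le]] := IH; first by move=> k kin; apply: hhs; rewrite inE kin orbT.
  have [mh sh] := hhs h (mem_head _ _).
  have [js ijs hE] := monic_factorization mh.
  exists (js ++ ks); split.
  - by move=> k; rewrite mem_cat => /orP[/ijs|/iks].
  - by rewrite big_cat /= -hE ksE big_cons.
  rewrite size_cat /= -add1n leq_add //; case: js hE {ijs} => // hE.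
  by move: sh; rewrite hE big_nil size_poly1.
by rewrite (perm_size (monic_irreducibles_unique igs iks _)) // ksE.
Qed.

Section Stability.
Variables (R : realType) (p : nat) (Q : padic_numbers R p) (K : fieldExtType Q).
Hypothesis p_pr : prime p.
Variables (F : finFieldType) (red : {rmorphism integers K -> F}).
Hypothesis hred : is_residue_field red.
Local Notation O := (integers K).
Local Notation toK := (\val : O -> K).
Local Notation pO := (p%:R : O).

Let mapD (a b : {poly O}) : map_poly toK (a + b) = map_poly toK a + map_poly toK b.
Proof. exact: rmorphD. Qed.

Let mapM (a b : {poly O}) : map_poly toK (a * b) = map_poly toK a * map_poly toK b.
Proof. exact: rmorphM. Qed.

Let mapC (x : O) : map_poly toK x%:P = (toK x)%:P.
Proof. exact: map_polyC. Qed.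

Lemma clear_denominators (u : {poly K}) :
  exists k (U : {poly O}), map_poly toK U = (p%:R ^+ k : K) *: u.
Proof.
have [k kP] := choice (fun i => integral_multiple p_pr u`_i).
pose N := \max_(i < size u) k i; exists N.
have [|U UE] := @integers_lift_poly _ _ _ K ((p%:R ^+ N : K) *: u); last by exists U.
move=> i; rewrite coefZ.
have [iu|] := ltnP i (size u); last by move=> /(nth_default 0) ->; rewrite mulr0; apply: integral0.
have -> : (p%:R : K) ^+ N * u`_i = p%:R ^+ (N - k i) * (p%:R ^+ k i *: u`_i).
  rewrite -[p%:R ^+ k i *: _]mulr_algl -in_algE rmorphXn rmorph_nat mulrA -exprD subnK //.
  exact: (leq_bigmax (Ordinal iu)).
apply: integral_mul => //; rewrite -natrX; exact: integral_nat.
Qed.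

Lemma integral_bezout (a b : {poly O}) : coprimep (map_poly toK a) (map_poly toK b) ->
  exists (c : nat) (U V : {poly O}), U * a + V * b = (pO ^+ c)%:P.
Proof.
move=> /Bezout_eq1_coprimepP[[u v] /= uv].
have [k [U UE]] := clear_denominators u; have [l [V VE]] := clear_denominators v.
exists (k + l)%N, ((pO ^+ l)%:P * U), ((pO ^+ k)%:P * V).
apply: integers_map_inj; rewrite mapD !mapM UE VE !mapC.
have pE m : toK (pO ^+ m) = p%:R ^+ m by rewrite rmorphXn rmorph_nat.
rewrite !pE -!mul_polyC !mulrA -!polyCM -!exprD [(l + k)%N]addnC -!mulrA -mulrDr uv mulr1.
by [].
Qed.

(** A relation [U * f + V * f' = p ^+ c] survives for [f1] up to a factor
    congruent to 1 modulo [p], and such a factor is not divisible by a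
    nonconstant monic integral polynomial, as its reduction is 1. *)
Lemma separable_stable (f : {poly O}) : f \is monic -> separable_poly (map_poly toK f) ->
  exists k, forall f1 : {poly O}, f1 \is monic -> rdvd (pO ^+ k)%:P (f1 - f) ->
    separable_poly (map_poly toK f1).
Proof.
move=> mf; rewrite {1}unlock deriv_map => /integral_bezout[c [U [V UV]]].
exists c.+1 => f1 mf1 [y yE].
have f1E : f1 = f + (pO ^+ c.+1)%:P * y by rewrite -yE addrC subrK.
have y'E : f1^`() = f^`() + (pO ^+ c.+1)%:P * y^`().
  by rewrite f1E derivD derivM derivC mul0r add0r.
pose z := 1 + pO%:P * (U * y + V * y^`()).
have zE : U * f1 + V * f1^`() = (pO ^+ c)%:P * z.
  rewrite y'E {1}f1E !mulrDr addrACA UV /z exprSr polyCM; ring.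
rewrite unlock; apply: contraT => nco.
have m1 : map_poly toK f1 \is monic by rewrite integers_map_monic.
have [gs igs f1gs] := monic_factorization m1.
have [g [gin gd]] : exists g, g \in gs /\ g %| (map_poly toK f1)^`().
  apply: contrapT => /forallNP H; move/negP: nco; apply.
  rewrite {1}f1gs big_seq.
  apply: (big_ind (fun h => coprimep h (map_poly toK f1)^`())) => [|x x' cx cx'|g gin].
  - exact: coprime1p.
  - by rewrite coprimepMl cx.
  case: (irreducible_coprimeVdvd (map_poly toK f1)^`() (igs g gin).2) => // gd.
  by case: (H g).
have gf1 : g %| map_poly toK f1 by rewrite f1gs (big_rem g) //= dvdp_mulr.
have [mg [sg _]] := igs g gin.
have [G mG GE] := integers_monic_dvd mf1 mg gf1.
have : g %| map_poly toK ((pO ^+ c)%:P * z).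
  by rewrite -zE mapD !mapM -deriv_map dvdp_add // dvdp_mull.
have pc0 : toK (pO ^+ c) != 0.
  by rewrite rmorphXn rmorph_nat expf_neq0 // -(rmorph_nat (in_alg K)) fmorph_eq0 p_neq0.
rewrite mapM mapC mul_polyC dvdpZr // -GE => /(integers_dvd mG)[h hE].
have := congr1 (map_poly red) hE.
rewrite rmorphD rmorph1 !rmorphM /= map_polyC /= (red_p p_pr hred) mul0r addr0 => e.
have : map_poly red G %| 1 by rewrite e dvdp_mull.
by rewrite dvdp1 size_red // -integers_map_size GE gtn_eqF.
Qed.

(** Hensel's lemma splits off one factor at a time, the remaining factor being
    close enough to its approximation for the induction hypothesis. *)
Lemma factors_stable (gs : seq {poly O}) : (forall g, g \in gs -> g \is monic) ->
  square_free (map_poly toK (\prod_(g <- gs) g)) ->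
  exists k, forall f1 : {poly O}, f1 \is monic -> size f1 = size (\prod_(g <- gs) g) ->
    rdvd (pO ^+ k)%:P (f1 - \prod_(g <- gs) g) ->
    exists gs1, [/\ forall g, g \in gs1 -> g \is monic, f1 = \prod_(g <- gs1) g &
      [seq size (g : {poly O}) | g <- gs1] = [seq size (g : {poly O}) | g <- gs]].
Proof.
elim: gs => [|g gs IH] mgs sqf.
  exists 0%N => f1 mf1; rewrite big_nil size_poly1 => s1 _; exists [::]; split=> //.
  have f1C := size1_polyC (eq_leq s1); rewrite big_nil f1C; congr (_%:P).
  by rewrite -(monicP mf1) lead_coefE s1.
move: sqf; rewrite big_cons mapM; set h := \prod_(i <- gs) i => sqf.
have mg := mgs g (mem_head _ _).
have mgs' k : k \in gs -> k \is monic by move=> kin; apply: mgs; rewrite inE kin orbT.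
have mh : h \is monic by rewrite /h big_seq; apply: monic_prod.
have [k kP] := IH mgs' (square_free_dvd sqf (dvdp_mull _ (dvdpp _))).
have [c [U [V UV]]] := integral_bezout (square_free_coprime sqf).
pose N := (c + k)%N; exists (N + N.+1)%N => f1 mf1 sf1 df1.
have bez : (pO ^+ k)%:P * U * g + (pO ^+ k)%:P * V * h = (pO ^+ N)%:P.
  by rewrite -!mulrA -mulrDr UV -polyCM -exprD addnC.
have [g1 [h1 [f1E [mg1 sg1] [mh1 sh1] _ dh1]]] :=
  hensel (integers_complete p_pr) (integers_separated p_pr) mg mh bez mf1 sf1 df1.
have [|gs1 [mgs1 h1E szE]] := kP h1 mh1 sh1.
  by apply: rdvd_trans dh1; rewrite !polyC_exp; apply: rdvd_exp; rewrite leqW // leq_addl.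
exists (g1 :: gs1); split; last by rewrite /= sg1 szE.
  by move=> x; rewrite inE => /predU1P[->|/mgs1].
by rewrite big_cons f1E h1E.
Qed.

Lemma square_free_separable (f : {poly K}) : square_free f -> separable_poly f.
Proof.
move=> sqf; apply/separable_polyP; split.
  apply/poly_square_freeP => u su; apply/negP => /sqf e; by rewrite e in su.
move=> u _; case su : (size u) => [|[|k]] // _; apply/eqP => u0.
have := congr1 (fun q : {poly K} => q`_k) u0; rewrite coef_deriv coef0 => /eqP.
have -> : u`_k.+1 = lead_coef u by rewrite lead_coefE su.
rewrite -mulr_natl mulf_eq0 lead_coef_eq0 -size_poly_eq0 su orbF -(rmorph_nat toK) => /eqP e.
have /eqP := integers_natr_neq0 K p_pr (ltn0Sn k).
by apply; apply: val_inj; rewrite e rmorph0.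
Qed.

(** * Sections of the sets of polynomials in the constant coefficient *)

Variables (m : nat) (w : m.-tuple O).

Definition section_poly (a : O) : {poly O} := monic_tuple [tuple of a :: w].

(** Allowing reducible factors makes these sets open for every condition
    [Lam] on the list of sizes. *)
Definition factor_sizes (Lam : seq nat -> Prop) : set O :=
  [set a | separable_poly (map_poly toK (section_poly a)) /\
    exists gs : seq {poly K}, [/\ forall g, g \in gs -> g \is monic /\ (1 < size g)%N,
      map_poly toK (section_poly a) = \prod_(g <- gs) g &
      Lam [seq size (g : {poly K}) | g <- gs]]]%classic.

Lemma section_poly_translate a b : section_poly (a + b) - section_poly a = b%:P.
Proof. by rewrite /section_poly !monic_tuple_cons polyCD; ring. Qed.

Lemma factor_sizes_open Lam : integers_open (factor_sizes Lam).
Proof.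
move=> a [sepf [gs [hgs fE lam]]]; set f := section_poly a in sepf fE.
have mf : f \is monic := monic_monic_tuple _.
have /choice[h hP] g : exists h : {poly O}, g \in gs -> h \is monic /\ map_poly toK h = g.
  case: (boolP (g \in gs)) => [gin|_]; last by exists 0.
  have gf : g %| map_poly toK f by rewrite fE (big_rem g) //= dvdp_mulr.
  by have [h mh hE] := integers_monic_dvd mf (hgs g gin).1 gf; exists h.
pose hs := [seq h g | g <- gs].
have fO : f = \prod_(g <- hs) g.
  apply: integers_map_inj; rewrite fE big_map rmorph_prod /= big_seq [RHS]big_seq.
  by apply: eq_bigr => g /hP[].
have mhs g : g \in hs -> g \is monic by move=> /mapP[g' /hP[mh _] ->].
have szhs : [seq size (g : {poly O}) | g <- hs] = [seq size (g : {poly K}) | g <- gs].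
  rewrite -map_comp; apply/eq_in_map => g /hP[_ /= {2}<-].
  by rewrite integers_map_size.
have sqf : square_free (map_poly toK f).
  by apply: coprime_deriv_square_free; move: sepf; rewrite unlock.
rewrite fO in sqf.
have [k1 k1P] := factors_stable mhs sqf; have [k2 k2P] := separable_stable mf sepf.
exists (k1 + k2)%N => y; pose f1 := section_poly (a + pO ^+ (k1 + k2) * y).
have mf1 : f1 \is monic := monic_monic_tuple _.
have df k : (k <= k1 + k2)%N -> rdvd (pO ^+ k)%:P (f1 - f).
  move=> kk; rewrite /f1 /f section_poly_translate polyCM; apply: rdvd_mulr.
  by rewrite !polyC_exp; apply: rdvd_exp.
have [||gs1 [mgs1 f1E szE]] := k1P f1 mf1.
- by rewrite -fO !size_monic_tuple.
- by rewrite -fO; apply: df; apply: leq_addr.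
split; first by apply: k2P => //; apply: df; apply: leq_addl.
exists [seq map_poly toK g | g <- gs1]; split.
- move=> _ /mapP[g gin ->]; rewrite integers_map_monic integers_map_size; split; first exact: mgs1.
  have : size g \in [seq size (g : {poly K}) | g <- gs] by rewrite -szhs -szE; apply/mapP; exists g.
  by move=> /mapP[g' /hgs[_ sg'] ->].
- by rewrite -/f1 f1E rmorph_prod big_map.
suff -> : [seq size (g : {poly K}) | g <- [seq map_poly toK g | g <- gs1]] =
    [seq size (g : {poly K}) | g <- gs] by [].
rewrite -szhs -szE -map_comp; apply: eq_map => g; exact: integers_map_size.
Qed.

(** A factorization is into irreducibles exactly when none has more nonconstant
    factors. *)
Lemma P_set_section mu : 
  [set a : O | P_set mu ([tuple of a :: w] : m.+1.-tuple (borel_integers K))]%classic =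
  (factor_sizes (fun s => sort geq (map predn s) = mu) `\`
   factor_sizes (fun s => (size mu < size s)%N))%classic.
Proof.
apply/seteqP; split => a /=.
  move=> [sqf [gs [igs fE muE]]]; have sepf := square_free_separable sqf.
  split.
    split=> //; exists gs; split=> //; last by rewrite -map_comp.
    by move=> g /igs[mg [sg _]].
  move=> [_ [hs [hhs fE' lt]]].
  have := factor_count_le igs hhs (etrans (esym fE) fE').
  by move: lt; rewrite -muE size_sort !size_map ltnNge => /negP nle /nle.
move=> [[sepf [gs [hgs fE muE]]] nW].
have sqf : square_free (map_poly toK (section_poly a)).
  by apply: coprime_deriv_square_free; move: sepf; rewrite unlock.
split=> //; exists gs; split=> //; last by rewrite -muE -map_comp.
move=> g gin; have [mg sg] := hgs g gin; split=> //.
have [ks iks gE] := monic_factorization mg.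
have [k1|nk1] := eqVneq (size ks) 1%N.
  case: ks k1 => [|k []] // _ in iks gE.
  by rewrite gE big_seq1; apply: (iks k (mem_head _ _)).2.
(* A reducible [g] would give a longer factorization. *)
have sk : (1 < size ks)%N.
  case: ks gE {iks} nk1 => [|k [|k' ks]] //= gE _.
  by move: sg; rewrite gE big_nil size_poly1.
case: nW; split=> //; exists (ks ++ rem g gs); split.
- move=> k; rewrite mem_cat => /orP[/iks[mk [sk' _]]|/mem_rem/hgs]//.
- by rewrite fE (big_rem g gin) big_cat /= -gE.
rewrite size_map size_cat size_rem // -muE size_sort !size_map.
case: gs gin {hgs fE muE} => //= x gs _.
by move: sk; move: (size ks) (size gs); lia.
Qed.

End Stability.

From mathcomp Require Import mathcomp_extra functions cardinality fsbigop.
From mathcomp Require Import lebesgue_integral probability.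
Local Open Scope classical_set_scope.

(** * Measures of sets defined by reduction *)

(** Immediate from the definition by a supremum over simple functions, which
    makes sense for nonmeasurable functions too. *)
Lemma ge0_integral_monotone d (T : measurableType d) (R : realType)
    (m : {measure set T -> \bar R}) (f g : T -> \bar R) :
  (forall x, 0 <= f x)%E -> (forall x, f x <= g x)%E ->
  (\int[m]_x f x <= \int[m]_x g x)%E.
Proof.
move=> f0 fg; have g0 x : (0 <= g x)%E by apply: le_trans (fg x).
rewrite !ge0_integralTE //; apply: le_ereal_sup => _ [h hf <-].
by exists h => // x; apply: le_trans (hf x) (fg x).
Qed.

(** The sections in the first coordinate are measured first, and the remaining
    integral over the tail is monotone even for nonmeasurable integrands. *)
Lemma power_probability_le d (T : measurableType d) (R : realType)
    (P : probability T R) n (A B : set (n.+1.-tuple T)) :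
  (forall w : n.-tuple T, measurable [set x | A [tuple of x :: w]]) ->
  (forall w : n.-tuple T, measurable [set x | B [tuple of x :: w]]) ->
  A `<=` B -> (power_probability P n.+1 A <= power_probability P n.+1 B)%E.
Proof.
move=> mA mB AB.
have secE (C : set (n.+1.-tuple T)) w :
    ysection (@tuple_cons _ T n @^-1` C) w = [set x | C [tuple of x :: w]].
  by apply/seteqP; split => x; rewrite /ysection /= inE.
rewrite /= /distribution /pushforward /product_measure2.
apply: ge0_integral_monotone => w; first exact: measure_ge0.
rewrite /= !secE; apply: le_measure; rewrite ?inE; last by move=> x; exact: AB.
  exact: mA.
exact: mB.
Qed.

Lemma measure_disjoint_family d (T : measurableType d) (R : realType)
    (m : {measure set T -> \bar R}) (I : finType) (B : I -> set T) (S : {set I}) (c : \bar R) :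
  (forall i, measurable (B i)) -> (forall i, m (B i) = c) ->
  trivIset setT B -> (0 <= c)%E ->
  measurable (\bigcup_(i in [set` S]) B i) /\
  m (\bigcup_(i in [set` S]) B i) = (#|S|%:R%:E * c)%E.
Proof.
move=> mB cB tB c0; have fS : finite_set [set` S] by exact: finite_finset.
split; first exact: fin_bigcup_measurable.
rewrite measure_fin_bigcup //; last exact: sub_trivIset tB.
have -> : [set` S] = [set` enum S] by apply/seteqP; split => i /=; rewrite mem_enum.
rewrite -fsbig_seq ?enum_uniq // big_enum /= (eq_bigr (fun=> c)) //.
rewrite big_const; elim: #|S| => [|k IH]; first by rewrite /= mul0e.
by rewrite iterS IH -natr1 EFinD ge0_muleDl ?mul1e 1?addeC // lee_fin.
Qed.

Section Haar.
Variables (R : realType) (p : nat) (Q : padic_numbers R p) (K : fieldExtType Q).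
Hypothesis p_pr : prime p.
Variables (F : finFieldType) (red : {rmorphism integers K -> F}).
Hypothesis hred : is_residue_field red.
Variable h : probability (borel_integers K) R.
Hypothesis h_haar : is_haar h.
Local Notation O := (integers K).
Local Notation q := (#|F|%:R : R).

Lemma open_measurable_integers (U : set O) : integers_open U ->
  measurable (U : set (borel_integers K)).
Proof. by move=> oU; apply: sub_sigma_algebra. Qed.

Definition fiber (z : F) : set (borel_integers K) := [set x | red x = z].

Lemma fiber_measurable z : measurable (fiber z).
Proof.
apply: open_measurable_integers => x xz; exists 1%N => y.
by rewrite /fiber /= rmorphD rmorphM expr1 (red_p p_pr hred) mul0r addr0.
Qed.

(** The residue classes are translates of one another. *)
Lemma fiber_measure z : h (fiber z) = (q^-1)%:E.
Proof.
have hE (z' : F) : h (fiber z') = h (fiber 0).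
  have [x xz] := hred.1 z'; rewrite -(h_haar x (fiber_measurable 0)); congr (h _).
  apply/seteqP; split => [y yz|_ [y y0 <-]].
    by exists (y - x); rewrite /fiber /= ?rmorphB ?yz ?xz ?subrr // addrC subrK.
  by rewrite /fiber /= rmorphD xz y0 addr0.
have tf : trivIset setT fiber.
  by apply/trivIsetP => a b _ _ ab; apply/seteqP; split => // y [/= ya yb];
     case/eqP: ab; rewrite -ya -yb.
have [_] := measure_disjoint_family [set: F]%SET fiber_measurable hE tf (measure_ge0 _ _).
have -> : \bigcup_(i in [set` [set: F]%SET]) fiber i = [set: borel_integers K].
  by apply/seteqP; split => // x _; exists (red x); rewrite //= inE.
move=> /(etrans (esym (probability_setT h))); rewrite cardsT hE.
have fin : h (fiber 0) \is a fin_num by exact: fin_num_measure (fiber_measurable 0).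
rewrite -(fineK fin) -EFinM => -[e]; congr (_%:E).
have q0 : q != 0 by rewrite pnatr_eq0 -lt0n (ltn_trans _ (finNzRing_gt1 F)).
by apply: (mulfI q0); rewrite -e divff.
Qed.

Definition box n (t : n.-tuple F) : set (n.-tuple (borel_integers K)) :=
  [set a : n.-tuple O | [tuple of map red a] = t].

Lemma box_measurable n (t : n.-tuple F) : measurable (box t).
Proof.
have -> : box t = \bigcap_(i in [set: 'I_n])
    ((fun a : n.-tuple (borel_integers K) => tnth a i) @^-1` fiber (tnth t i)).
  apply/seteqP; split => a /=.
    by move=> <- i _; rewrite /fiber /= tnth_map.
  by move=> H; apply: eq_from_tnth => i; rewrite tnth_map; apply: H.
apply: fin_bigcap_measurable => // i _; rewrite -[X in measurable X]setTI.
exact: (measurable_tnth i) measurableT _ (fiber_measurable _).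
Qed.

Lemma box_measure n (t : n.-tuple F) : power_probability h n (box t) = ((q^-1) ^+ n)%:E.
Proof.
elim: n t => [|n IH] t.
  by rewrite /= diracE /box mem_set //= tuple0 [RHS]tuple0.
rewrite /= /distribution /pushforward.
have -> : (@tuple_cons _ _ n @^-1` box t) = fiber (thead t) `*` box [tuple of behead t].
  apply/seteqP; split => -[x a] /=.
    by move=> <-; split; rewrite /fiber /box //=; apply: val_inj.
  move=> [xt at_]; rewrite /box /= [RHS]tuple_eta -xt; apply: val_inj => /=.
  by congr cons; move/(congr1 val): at_.
rewrite (product_measure2E _ _ (fiber_measurable _) (box_measurable _)) exprS EFinM.
by congr (_ * _)%E; [exact: fiber_measure | exact: IH].
Qed.

Definition reduces_into n (S : {set n.-tuple F}) : set (n.-tuple (borel_integers K)) :=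
  [set a : n.-tuple O | [tuple of map red a] \in S].

Lemma reduces_into_measure n (S : {set n.-tuple F}) :
  power_probability h n (reduces_into S) = (#|S|%:R / q ^+ n)%:E.
Proof.
have tf : trivIset setT (@box n).
  by apply/trivIsetP => a b _ _ ab; apply/seteqP; split => // y [/= ya yb];
     case/eqP: ab; rewrite -ya -yb.
have -> : reduces_into S = \bigcup_(t in [set` S]) box t.
  apply/seteqP; split => [a aS|a [t tS at_]]; first by exists [tuple of map red a].
  by have e : [tuple of map red a] = t := at_; rewrite /reduces_into /= e.
have [|_ ->] := measure_disjoint_family S (@box_measurable n) (@box_measure n) tf.
  by rewrite lee_fin exprn_ge0 // invr_ge0.
by rewrite -EFinM exprVn.
Qed.

Lemma reduces_into_section n (S : {set n.+1.-tuple F}) (w : n.-tuple O) :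
  measurable [set x : borel_integers K | reduces_into S [tuple of x :: w]].
Proof.
apply: open_measurable_integers => x xS; exists 1%N => y.
rewrite /reduces_into /=; congr (_ \in S): xS; apply: val_inj => /=.
by rewrite rmorphD rmorphM expr1 (red_p p_pr hred) mul0r addr0.
Qed.

End Haar.

(** * The limits *)

(** Upper and lower bounds of the count over the residue field, divided by
    [n`! * q ^ n]. *)
Lemma density_estimate (R : realType) (F : finFieldType) n mu (x : R) : (2 <= n)%N ->
  #|separable_of_type F n mu|%:R / #|F|%:R ^+ n <= x ->
  x <= #|separable_of_type F n mu :|: inseparable F n|%:R / #|F|%:R ^+ n ->
  `|x - nu R n mu| <= n%:R / #|F|%:R.
Proof.
move=> n2 lex xle; set s := #|separable_of_type F n mu| in lex *.
set q : R := #|F|%:R in lex xle *; set N := #|inseparable F n|.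
have q0 : 0 < q by rewrite ltr0n (ltn_trans _ (finNzRing_gt1 F)).
have qn0 : 0 < q ^+ n by rewrite exprn_gt0.
have f0 : (0 : R) < n`!%:R by rewrite ltr0n fact_gt0.
have xle' : x <= s%:R / q ^+ n + N%:R / q ^+ n.
  apply: le_trans xle _; rewrite -mulrDl ler_pM2r ?invr_gt0 // -natrD ler_nat.
  exact: leq_card_setU.
have NQ : N%:R / q ^+ n <= n%:R / q.
  rewrite ler_pdivrMr // -mulrA -[n in q ^+ n](prednK (ltnW n2)) exprS mulKf ?gt_eqF //.
  by rewrite -natrX -natrM ler_nat card_inseparable.
have up : s%:R / q ^+ n <= nu R n mu.
  rewrite /nu ler_pdivrMr // mulrAC ler_pdivlMr // -natrX -!natrM ler_nat mulnC.
  exact: card_separable_of_type_le.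
have lo : nu R n mu <= s%:R / q ^+ n + N%:R / q ^+ n.
  rewrite /nu -mulrDl ler_pdivrMr // mulrAC ler_pdivlMr // -natrX -natrD -!natrM ler_nat.
  by rewrite [leqRHS]mulnC; apply: card_separable_of_type_ge.
rewrite ler_distl; apply/andP; split; lra.
Qed.

Theorem theorem1p3 (R : realType) (n : nat) (mu : seq nat)
    (hn : (2 <= n)%N) (hmu : is_splitting_type n mu) :
  tends_as_residue_order_to_oo
    (fun p Q K h => power_probability h n (@Pstar_set R p Q K n mu)) (nu R n mu) /\
  tends_as_residue_order_to_oo
    (fun p Q K h => power_probability h n (@P_set R p Q K n mu)) (nu R n mu).
Proof.
case: n hn hmu => [|m] // hn _; set n := m.+1 in hn *.
suff main (e : R) : 0 < e -> exists q0 : nat,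
    forall (p : nat) (Q : padic_numbers R p) (K : fieldExtType Q)
      (h : probability (borel_integers K) R)
      (F : finFieldType) (red : {rmorphism integers K -> F}),
      prime p -> is_haar h -> is_residue_field red -> (q0 <= #|F|)%N ->
      (`|power_probability h n (@Pstar_set R p Q K n mu) - (nu R n mu)%:E| < e%:E)%E /\
      (`|power_probability h n (@P_set R p Q K n mu) - (nu R n mu)%:E| < e%:E)%E.
  by split=> e /main[q0 H]; exists q0 => p Q K h F red p1 p2 p3 /(H p Q K h F red p1 p2 p3)[].
move=> e0; have bnd0 : 0 <= n%:R / e by rewrite divr_ge0 // ltW.
exists (Num.bound (n%:R / e)) => p Q K h F red p_pr h_haar hred qF.
have small : n%:R / #|F|%:R < e.
  have q0 : (0 : R) < #|F|%:R by rewrite ltr0n (ltn_trans _ (finNzRing_gt1 F)).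
  rewrite ltr_pdivrMr // mulrC -ltr_pdivrMr //.
  by apply: lt_le_trans (archi_boundP bnd0) _; rewrite ler_nat.
set S := separable_of_type F n mu; set N := inseparable F n.
have PstarE : @Pstar_set R p Q K n mu = reduces_into red S.
  by apply/seteqP; split => a /(Pstar_setE p_pr hred mu hn).
have mS T := reduces_into_measure p_pr hred h_haar (T : {set n.-tuple F}).
have estimate (x : \bar R) : ((#|S|%:R / #|F|%:R ^+ n)%:E <= x)%E ->
    (x <= (#|S :|: N|%SET%:R / #|F|%:R ^+ n)%:E)%E -> (`|x - (nu R n mu)%:E| < e%:E)%E.
  case: x => [x| |] //=; rewrite !lee_fin => l u.
  by rewrite lte_fin; apply: le_lt_trans small; apply: density_estimate.
split.
  rewrite PstarE; apply: estimate; rewrite mS // lee_fin.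
  rewrite ler_pM2r ?invr_gt0 ?exprn_gt0 ?ltr0n ?(ltn_trans _ (finNzRing_gt1 F)) //.
  by rewrite ler_nat subset_leq_card // finset.subsetUl.
have mP (w : m.-tuple (integers K)) :
    measurable [set x : borel_integers K | P_set mu [tuple of x :: w]].
  have mo Lam : measurable (factor_sizes w Lam : set (borel_integers K)) :=
    open_measurable_integers (@factor_sizes_open _ _ _ _ p_pr _ _ hred _ w Lam).
  rewrite (P_set_section p_pr w mu).
  exact: measurableD (mo (fun s => sort geq (map predn s) = mu)) (mo _).
apply: estimate; rewrite -mS.
  apply: power_probability_le => // [w|]; first exact: reduces_into_section.
  by rewrite -PstarE => a [].
apply: power_probability_le => // [w|a]; first exact: reduces_into_section.
rewrite /reduces_into /= finset.in_setU => /(P_set_cases p_pr hred hn)[|->]; last by rewrite orbT.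
by move=> /(Pstar_setE p_pr hred mu hn) ->.
Qed.
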